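(* Let $e$ be a nonzero nilpotent element of even depth $d$ in a semisimple Lie algebra $\mathfrak g$ over an algebraically closed field of characteristic $0$, and suppose $e$ is of semisimple type. Then there exists a reducing subalgebra $\mathfrak q$ for $e$ such that $e\in\mathfrak q$ and $e$ is of regular semisimple type in $\mathfrak q$.
   Context: $G$ is the connected simply connected group with Lie algebra $\mathfrak g$; $\mathfrak s=\{e,h,f\}$ is an $\mathfrak{sl}_2$-triple containing $e$; $\mathfrak g_j$ is the $j$-eigenspace of $\mathrm{ad}\,h$, and the depth $d$ is the largest $j$ with $\mathfrak g_j\ne0$. A cyclic element associated with $e$ is $e+F$ with $0\ne F\in\mathfrak g_{-d}$; $e$ is of semisimple (resp. regular semisimple) type if $e+F$ is semisimple (resp. regular semisimple, i.e. semisimple with centralizer a Cartan subalgebra) for all $F$ in a nonempty Zariski open subset of $\mathfrak g_{-d}$. $Z(\mathfrak s)$ is the centralizer of $\mathfrak s$ in $G$. A reducing subalgebra for $e$ is a semisimple subalgebra $\mathfrak q\subset\mathfrak g$ with $[\mathfrak s,\mathfrak q]\subset\mathfrak q$ such that $Z(\mathfrak s)(\mathfrak q\cap\mathfrak g_{-d})$ is Zariski dense in $\mathfrak g_{-d}$. *)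

(* Defs.v *)
(* Lie algebras are modelled concretely as F^n ('rV[F]_n)
   with a bracket; subspaces/subalgebras are row spaces of square matrices
   (mxalgebra %MS). *)
From HB Require Import structures.
From mathcomp Require Import all_boot all_order all_algebra all_field.
Set Implicit Arguments. Unset Strict Implicit. Unset Printing Implicit Defensive.
Import Order.TTheory GRing.Theory Num.Theory.
Local Open Scope ring_scope.

Section LieDefs.
Variables (F : fieldType) (n : nat).
Variable br : 'rV[F]_n -> 'rV[F]_n -> 'rV[F]_n.

Definition lie_bracket : Prop :=
  [/\ (forall (a : F) x y z, br (a *: x + y) z = a *: br x z + br y z),
      (forall (a : F) x y z, br x (a *: y + z) = a *: br x y + br x z),
      (forall x, br x x = 0) &
      (forall x y z, br x (br y z) + br y (br z x) + br z (br x y) = 0)].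

Definition ad (x : 'rV[F]_n) : 'M[F]_n := lin1_mx (br x).

Definition brs (A B : 'M[F]_n) : 'M[F]_n :=
  (\sum_(i < n) \sum_(j < n) <<br (row i A) (row j B)>>)%MS.

Definition subalgebra (A : 'M[F]_n) : Prop := (brs A A <= A)%MS.
Definition ideal_in (Q I : 'M[F]_n) : Prop :=
  (I <= Q)%MS /\ (brs Q I <= I)%MS.
Definition derived (A : 'M[F]_n) (k : nat) : 'M[F]_n :=
  iter k (fun X => brs X X) A.
Definition solvable_sub (A : 'M[F]_n) : Prop :=
  exists k, (derived A k <= (0 : 'M[F]_n))%MS.
Definition lcs (A : 'M[F]_n) (k : nat) : 'M[F]_n := iter k (fun X => brs A X) A.
Definition nilpotent_sub (A : 'M[F]_n) : Prop := exists k, (lcs A k <= (0 : 'M[F]_n))%MS.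

Definition semisimple_lie (Q : 'M[F]_n) : Prop :=
  forall I, ideal_in Q I -> solvable_sub I -> (I <= (0 : 'M[F]_n))%MS.

Definition cartan_in (Q C : 'M[F]_n) : Prop :=
  [/\ (C <= Q)%MS, subalgebra C, nilpotent_sub C &
      forall y, (y <= Q)%MS ->
        (forall z, (z <= C)%MS -> (br y z <= C)%MS) -> (y <= C)%MS].

Definition nilpotent_elt (x : 'rV[F]_n) : Prop := exists k, ad x ^+ k = 0.

Definition semisimple_elt (Q : 'M[F]_n) (x : 'rV[F]_n) : Prop :=
  exists k (B : 'M[F]_(k, n)) (a : 'I_k -> F),
    (B == Q)%MS /\ forall i, row i B *m ad x = a i *: row i B.

Definition regular_semisimple_elt (Q : 'M[F]_n) (x : 'rV[F]_n) : Prop :=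
  semisimple_elt Q x /\ cartan_in Q (Q :&: kermx (ad x))%MS.

Definition sl2_triple (e h f : 'rV[F]_n) : Prop :=
  [/\ br h e = 2%:R *: e, br h f = - (2%:R *: f) & br e f = h].

Definition grade (Q : 'M[F]_n) (h : 'rV[F]_n) (j : int) : 'M[F]_n :=
  (Q :&: eigenspace (ad h) (j%:~R))%MS.

Definition is_depth (Q : 'M[F]_n) (h : 'rV[F]_n) (d : nat) : Prop :=
  ~~ (grade Q h d%:Z <= (0 : 'M[F]_n))%MS /\
  forall j : int, d%:Z < j -> (grade Q h j <= (0 : 'M[F]_n))%MS.

Inductive polyfun : ('rV[F]_n -> F) -> Prop :=
| pf_const (c : F) : polyfun (fun _ => c)
| pf_coord (i : 'I_n) : polyfun (fun v => v 0 i)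
| pf_add p q : polyfun p -> polyfun q -> polyfun (fun v => p v + q v)
| pf_mul p q : polyfun p -> polyfun q -> polyfun (fun v => p v * q v).

(* P holds on a nonempty Zariski open subset of the subspace V:
   the open set is V minus the common zero locus of a family S of
   polynomial functions. *)
Definition generic_on (V : 'M[F]_n) (P : 'rV[F]_n -> Prop) : Prop :=
  exists S : ('rV[F]_n -> F) -> Prop,
    [/\ (forall p, S p -> polyfun p),
        (exists v, (v <= V)%MS /\ exists p, S p /\ p v != 0) &
        (forall v, (v <= V)%MS -> (exists p, S p /\ p v != 0) -> P v)].

Definition dense_in (V : 'M[F]_n) (W : 'rV[F]_n -> Prop) : Prop :=
  forall p, polyfun p -> (forall w, W w -> p w = 0) ->
    forall v, (v <= V)%MS -> p v = 0.

(* exponential of a (nilpotent) matrix *)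
Definition expmx (N : 'M[F]_n) : 'M[F]_n :=
  \sum_(k < n.+1) (k`!%:R)^-1 *: N ^+ k.

(* Int(g) = Ad(G) for G the simply connected group: the group generated by
   exp(ad x), x nilpotent. *)
Inductive adjoint_group : 'M[F]_n -> Prop :=
| ag1 : adjoint_group 1%:M
| agexp x A : nilpotent_elt x -> adjoint_group A ->
              adjoint_group (expmx (ad x) *m A).

(* image of Z(s) under Ad *)
Definition centralizer_s (e h f : 'rV[F]_n) (phi : 'M[F]_n) : Prop :=
  [/\ adjoint_group phi, e *m phi = e, h *m phi = h & f *m phi = f].

Definition semisimple_type (Q : 'M[F]_n) (e h : 'rV[F]_n) (d : nat) : Prop :=
  generic_on (grade Q h (- d%:Z)) (fun x => semisimple_elt Q (e + x)).

Definition regular_semisimple_type_for (Q : 'M[F]_n) (e h : 'rV[F]_n) (d : nat)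
  : Prop :=
  generic_on (grade Q h (- d%:Z)) (fun x => regular_semisimple_elt Q (e + x)).

Definition regular_semisimple_type_in (Q : 'M[F]_n) (e : 'rV[F]_n) : Prop :=
  exists h' f' d', [/\ (h' <= Q)%MS, (f' <= Q)%MS, sl2_triple e h' f',
     is_depth Q h' d' & regular_semisimple_type_for Q e h' d'].

Definition reducing (e h f : 'rV[F]_n) (d : nat) (q : 'M[F]_n) : Prop :=
  [/\ subalgebra q /\ semisimple_lie q,
      (q *m ad e <= q)%MS, (q *m ad h <= q)%MS, (q *m ad f <= q)%MS &
      dense_in (grade 1%:M h (- d%:Z))
        (fun v => exists phi y, centralizer_s e h f phi /\
            (y <= q :&: grade 1%:M h (- d%:Z))%MS /\ v = y *m phi)].

End LieDefs.

(* Main.v *)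
(* Write zs for the centralizer of the sl2-triple, V = g_(-d), and choose F in V
   with e + F semisimple and [zs, F] of maximal dimension. Rank semicontinuity
   along F + tG shows that L = zs /\ z(F) maps V into [zs, F]. Let a be an
   ad-semisimple element of L with smallest centralizer c = z(a), and put
   q = [c, c].

   The Killing form is nondegenerate on L, c and q, and every element of L
   commuting with a turns out to be central in c; hence q /\ L = 0. For generic
   F' in q /\ V the centralizer of e + F' in q is reductive and zeta^(ad h)
   (zeta a primitive (d+2)-th root of unity) acts on it with fixed space
   q /\ zs /\ z(F') = 0, so it is abelian by Kreknin's argument, that is, a
   Cartan subalgebra of q.

   Since ad a is diagonalizable, V is the sum of V /\ c = V /\ q and of
   eigenspaces for nonzero eigenvalues; the latter consist of elements [x, F]
   with x in zs an eigenvector of ad a for a nonzero eigenvalue, hence nilpotent.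
   Therefore the exponentials exp(ad x) move V /\ q in all directions at F, which
   gives density. *)

Require Import Defs.
From HB Require Import structures.
From mathcomp Require Import all_boot all_order all_algebra all_field.
From mathcomp Require Import cyclic ring zify.
From Stdlib Require Import Classical.
Set Implicit Arguments. Unset Strict Implicit. Unset Printing Implicit Defensive.
Import Order.TTheory GRing.Theory Num.Theory.
Local Open Scope ring_scope.

(** * Spectral projections and Jordan decomposition *)

(** Reductivity is expressed throughout by nondegeneracy of the Killing form of the whole algebra on
    a subspace. This property passes to the kernel of a diagonalizable skew map, to the fixed space
    of a diagonalizable isometry, and to derived subalgebras. As [semisimple_lie] only forbids
    solvable ideals, Cartan's criterion has to be proved first, over a field without complex
    conjugation. The inclusion of [L, V] in [zs, F] says that L acts trivially on the normal space
    V/[zs, F]; it does the work of a slice theorem. The element a plays the part of a generic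
    element of a maximal torus of L. What is left of the stabilizer of F inside c is central there,
    and passing to [c, c] discards it, so that no fixed points obstruct Kreknin's argument. The
    group is known only through generators exp(ad x) with x nilpotent, so every direction leaving q
    must be produced by a nilpotent element of zs. Splitting V by the eigenvalues of ad a provides
    exactly such elements. *)

(** Serves every choice of an object of maximal rank: the predicates are undecided propositions, so
    the maximum is found classically from the bound. *)
Lemma ex_maxP (T : Type) (f : T -> nat) (N : nat) (Q : T -> Prop) :
  (exists x, Q x) -> (forall x, Q x -> (f x <= N)%N) ->
  exists2 x, Q x & forall y, Q y -> (f y <= f x)%N.
Proof.
move=> [x0 Qx0] QN; apply: NNPP => nomax.
suff H k : exists2 x, Q x & (k <= f x)%N.
  by have [x Qx] := H N.+1; rewrite ltnNge QN.
elim: k => [|k [x Qx kx]]; first by exists x0.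
apply: NNPP => nok; apply: nomax; exists x => // y Qy.
rewrite leqNgt; apply/negP => xy; apply: nok; exists y => //.
exact: leq_ltn_trans kx xy.
Qed.

Lemma mulmx_subP (K : fieldType) m n p q (U : 'M[K]_(m, n)) (A : 'M_(n, p)) (W : 'M_(q, p)) :
  (forall v : 'rV_n, (v <= U)%MS -> (v *m A <= W)%MS) -> (U *m A <= W)%MS.
Proof. by move=> H; apply/row_subP => i; rewrite row_mul; apply/H/row_sub. Qed.

Lemma natr_pchar_inj (F : fieldType) : [pchar F] =i pred0 -> injective (fun k : nat => k%:R : F).
Proof.
move=> ch0 i j; wlog ij : i j / (i <= j)%N.
  by move=> H; case: (leqP i j) => [/H|/ltnW /H] // H1 /esym /H1.
rewrite -(subnKC ij) natrD -{1}[i%:R]addr0 => /addrI /esym /eqP.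
by rewrite (proj1 (pcharf0P F) ch0) => /eqP ->; rewrite addn0.
Qed.

Section LinearAlgebra.

(** Write A = CR with C of full column rank and R of full row rank: tr(CR) = tr(RC), and the smaller
    matrix RC has its nilpotency exponent lowered by one. *)
Lemma mxtrace_nilp (F : fieldType) (k n : nat) (A : 'M[F]_n) :
  A ^+ k = 0 -> \tr A = 0.
Proof.
elim: k n A => [|k IHk] n A Ak.
  by rewrite -[A]mulr1 -(expr0 A) Ak mulr0 mxtrace0.
rewrite -(mulmx_base A) mxtrace_mulC; apply: IHk.
set C := col_base A; set R := row_base A.
have CR j : A ^+ j.+1 = C *m (R *m C) ^+ j *m R.
  elim: j => [|j IHj]; first by rewrite expr1 expr0 mulmx1 mulmx_base.
  transitivity (C *m (R *m C) ^+ j *m R *m (C *m R)).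
    by rewrite mulmx_base exprSr IHj.
  by rewrite [in RHS]exprSr -mulmxE !mulmxA.
move: Ak; rewrite CR => /eqP; rewrite -(mul0mx _ R) => /eqP.
move/(row_free_inj (row_base_free A)) => CRC0.
by apply: (row_full_inj (col_base_full A)); rewrite CRC0 mulmx0.
Qed.

Lemma mxtrace_idem (F : fieldType) (n : nat) (E : 'M[F]_n) :
  E *m E = E -> \tr E = (\rank E)%:R.
Proof.
move=> EE; rewrite -{1}(mulmx_base E) mxtrace_mulC.
suff -> : row_base E *m col_base E = 1%:M by rewrite mxtrace1.
set C := col_base E; set R := row_base E.
have: C *m (R *m C) *m R = C *m 1%:M *m R.
  by rewrite mulmx1 mulmxA mulmx_base -mulmxA mulmx_base.
by move/(row_free_inj (row_base_free E))/(row_full_inj (col_base_full E)).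
Qed.

Variables (F : closedFieldType) (n' : nat).
Local Notation n := n'.+1.
Implicit Types (A B D : 'M[F]_n) (a b : F) (p q : {poly F}).

(** [P a] evaluated at A is the projection onto the generalized eigenspace of [a]; k = 1 is the
    diagonalizable case. As polynomials in A, the projections preserve every A-stable row space and
    commute with whatever commutes with A. Some [a] in [rs] may have projection 0. *)
Definition spectral A k (rs : seq F) (P : F -> {poly F}) : Prop :=
  [/\ uniq rs, \sum_(a <- rs) horner_mx A (P a) = 1%:M &
      forall a, a \in rs -> horner_mx A (P a) *m (A - a%:M) ^+ k = 0].

Definition sdiag A : Prop :=
  exists2 rs : seq F, uniq rs & horner_mx A (\prod_(a <- rs) ('X - a%:P)) = 0.

Lemma horner_mx1 A : horner_mx A 1 = 1%:M.
Proof. exact: rmorph1. Qed.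

Lemma horner_mxM A p q : horner_mx A (p * q) = horner_mx A p *m horner_mx A q.
Proof. by rewrite rmorphM. Qed.

Lemma horner_mx_XsubCn A a k : horner_mx A (('X - a%:P) ^+ k) = (A - a%:M) ^+ k.
Proof. by rewrite rmorphXn /= rmorphB /= horner_mx_X horner_mx_C. Qed.

Lemma coprime_kill m (W : 'M[F]_(m, n)) A p q : coprimep p q ->
  W *m horner_mx A p = 0 -> W *m horner_mx A q = 0 -> W = 0.
Proof.
move=> /Bezout_eq1_coprimepP [[u v] /= uv1] Wp Wq.
have H : horner_mx A (p * u + q * v) = 1%:M.
  by rewrite mulrC [q * v]mulrC uv1 rmorph1.
rewrite -[W]mulmx1 -H rmorphD /= -!/(horner_mx _ _) !horner_mxM mulmxDr !mulmxA.
by rewrite Wp Wq !mul0mx addr0.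
Qed.

Lemma coprime_XsubCn a b j k : a != b ->
  coprimep (('X - a%:P) ^+ j) (('X - b%:P) ^+ k).
Proof.
move=> ab; apply/coprimep_expl/coprimep_expr.
by rewrite coprimep_XsubC root_XsubC eq_sym.
Qed.

(** Chinese remainder idempotents, built one root at a time from a Bezout relation between the new
    factor and the product of the old ones. *)
Lemma spectral_of_kill A k rs : uniq rs ->
  horner_mx A (\prod_(a <- rs) ('X - a%:P) ^+ k) = 0 ->
  exists P, spectral A k rs P.
Proof.
move=> Urs Kill.
suff [P [sum1 Pd]] : exists P : F -> {poly F},
    \prod_(a <- rs) ('X - a%:P) ^+ k %| 1 - \sum_(a <- rs) P a /\
    forall a, a \in rs ->
      \prod_(a <- rs) ('X - a%:P) ^+ k %| P a * ('X - a%:P) ^+ k.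
  exists P; split=> //.
    have /dvdpP [q Eq] := sum1.
    have : horner_mx A (1 - \sum_(a <- rs) P a) = 0.
      by rewrite Eq horner_mxM Kill mulmx0.
    by rewrite raddfB raddf_sum /= horner_mx1 => /eqP; rewrite subr_eq0 => /eqP <-.
  move=> a /Pd /dvdpP [q Eq]; rewrite -horner_mx_XsubCn -horner_mxM Eq.
  by rewrite horner_mxM Kill mulmx0.
elim: rs Urs {Kill} => [|a rs IHrs] /=.
  by move=> _; exists (fun=> 0); rewrite !big_nil subr0.
move=> /andP [ars /IHrs {IHrs} [P [sum1 Pd]]].
have cop : coprimep (('X - a%:P) ^+ k) (\prod_(b <- rs) ('X - b%:P) ^+ k).
  elim: rs ars {sum1 Pd} => [|b rs IHrs]; first by rewrite big_nil coprimep1.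
  rewrite inE big_cons negb_or => /andP [ab /IHrs cop].
  by rewrite coprimepMr cop coprime_XsubCn.
have [[u v] /= uv1] := Bezout_eq1_coprimepP _ _ cop.
exists (fun b => if b == a then v * \prod_(b <- rs) ('X - b%:P) ^+ k
         else u * ('X - a%:P) ^+ k * P b); split.
  rewrite !big_cons eqxx.
  have -> : \sum_(b <- rs) (if b == a then v * \prod_(b <- rs) ('X - b%:P) ^+ k
         else u * ('X - a%:P) ^+ k * P b) = u * ('X - a%:P) ^+ k * \sum_(b <- rs) P b.
    rewrite mulr_sumr; apply: eq_big_seq => b brs.
    by case: eqP => // ba; rewrite -ba brs in ars.
  set Q := \prod_(_ <- _) _ in sum1 uv1 *; set T := \sum_(_ <- _) _ in sum1 *.
  have -> : 1 - (v * Q + u * ('X - a%:P) ^+ k * T) = u * (('X - a%:P) ^+ k * (1 - T)).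
    rewrite mulrA mulrBr mulr1 opprD addrA; congr (_ - _).
    by rewrite -[X in X - _]uv1 addrK.
  by rewrite dvdp_mull // dvdp_mul.
move=> b; rewrite inE big_cons => /orP [/eqP ->|brs].
  by rewrite eqxx mulrC dvdp_mul // dvdp_mull.
case: eqP => [ba|_]; first by rewrite -ba brs in ars.
have -> : u * ('X - a%:P) ^+ k * P b * ('X - b%:P) ^+ k =
    u * (('X - a%:P) ^+ k * (P b * ('X - b%:P) ^+ k)) by rewrite !mulrA.
by apply: dvdp_mull; apply: dvdp_mul => //; apply: Pd.
Qed.

Lemma spectral_ex A : exists rs P, spectral A n rs P.
Proof.
have [rs Ers] := closed_field_poly_normal (char_poly A).
rewrite (monicP (char_poly_monic A)) scale1r in Ers.
have srs : size rs = n.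
  by apply: succn_inj; rewrite -(size_char_poly A) Ers size_prod_XsubC.
exists (undup rs); apply: spectral_of_kill (undup_uniq rs) _.
have /dvdpP [q ->] : char_poly A %| \prod_(a <- undup rs) ('X - a%:P) ^+ n.
  rewrite Ers -prodr_undup_exp_count big_seq [X in _ %| X]big_seq.
  elim/big_rec2: _ => // a p q _ pq; rewrite dvdp_mul // dvdp_exp2l //.
  by rewrite -srs count_size.
by rewrite horner_mxM Cayley_Hamilton mulmx0.
Qed.

Lemma spectral_filter A k rs P : spectral A k rs P ->
  spectral A k [seq a <- rs | horner_mx A (P a) != 0] P.
Proof.
case=> Urs s1 PA; split; first exact: filter_uniq.
  rewrite -s1 big_filter big_mkcond; apply: eq_bigr => a _.
  by case: eqP => // ->.
by move=> a; rewrite mem_filter => /andP [_ /PA].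
Qed.

Lemma sdiag_spectral A : sdiag A -> exists rs P, spectral A 1 rs P.
Proof. by case=> rs Urs K; exists rs; apply: spectral_of_kill. Qed.

Section Spectral.
Variables (A : 'M[F]_n) (k : nat) (rs : seq F) (P : F -> {poly F}).
Hypothesis sA : spectral A k rs P.
Notation E a := (horner_mx A (P a)).

Lemma spectralE m (W : 'M[F]_(m, n)) : W = \sum_(a <- rs) W *m E a.
Proof. by case: sA => _ s1 _; rewrite -mulmx_sumr s1 mulmx1. Qed.

Lemma spectral_proj m (W : 'M[F]_(m, n)) b j : W *m (A - b%:M) ^+ j = 0 ->
  forall a, a \in rs -> W *m E a = if a == b then W else 0.
Proof.
case: (sA) => Urs _ PA Wb.
have W0 a : a \in rs -> a != b -> W *m E a = 0.
  move=> ars ab; apply: (coprime_kill (A := A) (coprime_XsubCn k j ab)).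
    by rewrite horner_mx_XsubCn -mulmxA PA ?mulmx0.
  rewrite horner_mx_XsubCn -mulmxA.
  have -> : E a *m (A - b%:M) ^+ j = (A - b%:M) ^+ j *m E a.
    by rewrite -horner_mx_XsubCn; exact: comm_horner_mx2.
  by rewrite mulmxA Wb mul0mx.
move=> a ars; case: eqP => [ab|/eqP ab]; last exact: W0.
rewrite [RHS](spectralE W) (bigD1_seq a) //= big_seq_cond big1 ?addr0 //.
by move=> c /andP [crs ca]; rewrite W0 // -ab.
Qed.

Lemma spectral_notin m (W : 'M[F]_(m, n)) b j : W *m (A - b%:M) ^+ j = 0 ->
  b \notin rs -> W = 0.
Proof.
move=> Wb brs; rewrite (spectralE W) big_seq big1 // => a ars.
by rewrite (spectral_proj Wb) //; case: eqP ars brs => // -> ->.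
Qed.

Lemma spectral_idem a : a \in rs -> E a *m E a = E a.
Proof.
case: (sA) => _ _ PA ars.
by rewrite (spectral_proj (PA a ars)) ?eqxx.
Qed.

Lemma spectral_stable (U : 'M[F]_n) m (W : 'M[F]_(m, n)) a :
  (U *m A <= U)%MS -> (W <= U)%MS -> (W *m E a <= U)%MS.
Proof.
move=> UA WU; apply: submx_trans (submxMr _ WU) _.
exact: horner_mx_stable.
Qed.

End Spectral.

Lemma mulmx_expr0 m (W : 'M[F]_(m, n)) A j k : (j <= k)%N ->
  W *m A ^+ j = 0 -> W *m A ^+ k = 0.
Proof. by move=> jk Wj; rewrite -(subnKC jk) exprD -mulmxE mulmxA Wj mul0mx. Qed.

Lemma sdiag_sum (I : eqType) (s : seq I) (E : I -> 'M[F]_n) (c : I -> F) D :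
  \sum_(i <- s) E i = 1%:M ->
  (forall i, i \in s -> E i *m (D - (c i)%:M) = 0) -> sdiag D.
Proof.
move=> s1 Ec; exists (undup [seq c i | i <- s]); first exact: undup_uniq.
rewrite -[horner_mx _ _]mul1mx -s1 mulmx_suml big_seq big1 // => i si.
have /dvdpP [q ->] : 'X - (c i)%:P %| \prod_(a <- undup [seq c i | i <- s]) ('X - a%:P).
  by rewrite dvdp_XsubCl root_prod_XsubC mem_undup map_f.
by rewrite mulrC horner_mxM mulmxA -['X - _]expr1 horner_mx_XsubCn expr1 Ec ?mul0mx.
Qed.

(** The last clause describes S on all generalized eigenvectors of A; later arguments use it where
    uniqueness of the decomposition is customary. *)
Lemma jordan A : exists S N, [/\ A = S + N, (exists p, S = horner_mx A p),
  sdiag S, N ^+ n = 0 &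
  forall m (W : 'M[F]_(m, n)) b j, W *m (A - b%:M) ^+ j = 0 -> W *m S = b *: W].
Proof.
have [rs [P sA]] := spectral_ex A; have [Urs s1 PA] := sA.
pose S := \sum_(a <- rs) a *: horner_mx A (P a).
have SE : forall m (W : 'M[F]_(m, n)) b j, W *m (A - b%:M) ^+ j = 0 -> W *m S = b *: W.
  move=> m W b j Wb; rewrite {2}(spectralE sA W) mulmx_sumr scaler_sumr.
  apply: eq_big_seq => a ars; rewrite -scalemxAr (spectral_proj sA Wb) //.
  by case: eqP => [->|_]; rewrite ?scaler0.
have Sp : S = horner_mx A (\sum_(a <- rs) a *: P a).
  by rewrite raddf_sum; apply: eq_bigr => a _; rewrite /= horner_mxZ.
exists S, (A - S); split=> //; first by rewrite addrC subrK.
- by exists (\sum_(a <- rs) a *: P a).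
- apply: (sdiag_sum (c := id) s1) => a ars.
  by rewrite mulmxBr (SE _ _ _ _ (PA a ars)) mul_mx_scalar subrr.
have cAS : GRing.comm A S by rewrite Sp -{1}(horner_mx_X A); exact: comm_horner_mx2.
have EN a j : a \in rs -> horner_mx A (P a) *m (A - S) ^+ j = horner_mx A (P a) *m (A - a%:M) ^+ j.
  move=> ars; elim: j => [|j IHj]; first by rewrite !expr0.
  rewrite !exprSr -!mulmxE !mulmxA IHj !mulmxBr; congr (_ - _).
  rewrite -horner_mx_XsubCn.
  have cc p q : horner_mx A p *m horner_mx A q = horner_mx A q *m horner_mx A p.
    exact: comm_horner_mx2.
  rewrite cc -mulmxA (SE _ _ _ _ (PA a ars)) mul_mx_scalar -scalemxAr.
  by [].
rewrite -[_ ^+ _]mul1mx -s1 mulmx_suml big_seq big1 // => a ars.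
by rewrite EN // PA.
Qed.

Lemma mxtrace_comm_nilp A B k : A *m B = B *m A -> A ^+ k = 0 -> \tr (A *m B) = 0.
Proof.
move=> cAB Ak; apply: (@mxtrace_nilp _ k).
have cc : GRing.comm A B by [].
by rewrite mulmxE exprMn_comm // Ak mul0r.
Qed.

Lemma spectral_trace A rs P a : spectral A n rs P -> a \in rs ->
  \tr (horner_mx A (P a) *m A) = a * (\rank (horner_mx A (P a)))%:R.
Proof.
move=> sA ars; have [Urs s1 PA] := sA; set E := horner_mx A (P a).
rewrite -(mxtrace_idem (spectral_idem sA ars)) -/E -mxtraceZ.
apply/eqP; rewrite -subr_eq0 -raddfB /= -mul_mx_scalar -mulmxBr; apply/eqP.
apply: (@mxtrace_nilp _ n).
have cc : GRing.comm E (A - a%:M).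
  have := horner_mx_XsubCn A a 1; rewrite !expr1 => <-.
  exact: comm_horner_mx2.
rewrite mulmxE exprMn_comm //; have := PA a ars; rewrite -/E mulmxE => EA.
by rewrite [E ^+ _]exprSr -mulrA EA mulr0.
Qed.

(** For the projection onto the generalized eigenspace of [a] the trace is [a] times a rank, so in
    characteristic 0 every nonzero [a] has projection 0. *)
Lemma nilpotent_of_traces A : [pchar F] =i pred0 ->
  (forall p, \tr (horner_mx A p *m A) = 0) -> A ^+ n = 0.
Proof.
move=> ch0 tr0; have [rs [P sA]] := spectral_ex A; have [Urs s1 PA] := sA.
have E0 a : a \in rs -> a != 0 -> horner_mx A (P a) = 0.
  move=> ars a0; have := spectral_trace sA ars.
  rewrite tr0 => /esym /eqP; rewrite mulf_eq0 (negPf a0) /=.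
  by rewrite (proj1 (pcharf0P F) ch0) mxrank_eq0 => /eqP.
rewrite -[_ ^+ _]mul1mx -s1 mulmx_suml big_seq big1 // => a ars.
have [a0|a0] := eqVneq a 0; last by rewrite E0 ?mul0mx.
by have := PA a ars; rewrite a0 raddf0 subr0.
Qed.

End LinearAlgebra.

(** * Lie brackets, derivations and the trace form *)

Structure lieBracket (F : fieldType) (n : nat) := LieBracket {
  bracket :> 'rV[F]_n -> 'rV[F]_n -> 'rV[F]_n;
  bracketP : lie_bracket bracket;
  bracket_pchar : [pchar F] =i pred0 }.

Section Bracket.
Variables (F : closedFieldType) (n' : nat).
Local Notation n := n'.+1.
Variable br : lieBracket F n.
Implicit Types (x y z u v : 'rV[F]_n) (A B C U : 'M[F]_n) (a b : F).

Lemma natr_neq0 m : (m.+1%:R : F) != 0.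
Proof. by rewrite (proj1 (pcharf0P F) (bracket_pchar br)). Qed.

Lemma brDl x y z : br (x + y) z = br x z + br y z.
Proof. by case: (bracketP br) => H _ _ _; have := H 1 x y z; rewrite !scale1r. Qed.

Lemma brDr x y z : br x (y + z) = br x y + br x z.
Proof. by case: (bracketP br) => _ H _ _; have := H 1 x y z; rewrite !scale1r. Qed.

Lemma br0l x : br 0 x = 0.
Proof. by apply: (addrI (br 0 x)); rewrite -brDl !addr0. Qed.

Lemma br0r x : br x 0 = 0.
Proof. by apply: (addrI (br x 0)); rewrite -brDr !addr0. Qed.

Lemma brZl a x y : br (a *: x) y = a *: br x y.
Proof. by case: (bracketP br) => H _ _ _; have := H a x 0 y; rewrite br0l !addr0. Qed.

Lemma brZr a x y : br x (a *: y) = a *: br x y.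
Proof. by case: (bracketP br) => _ H _ _; have := H a x y 0; rewrite br0r !addr0. Qed.

Lemma brNl x y : br (- x) y = - br x y.
Proof. by rewrite -scaleN1r brZl scaleN1r. Qed.

Lemma brNr x y : br x (- y) = - br x y.
Proof. by rewrite -scaleN1r brZr scaleN1r. Qed.

Lemma brBl x y z : br (x - y) z = br x z - br y z.
Proof. by rewrite brDl brNl. Qed.

Lemma brBr x y z : br x (y - z) = br x y - br x z.
Proof. by rewrite brDr brNr. Qed.

Lemma brxx x : br x x = 0.
Proof. by case: (bracketP br). Qed.

Lemma brC x y : br x y = - br y x.
Proof.
apply/eqP; rewrite -addr_eq0; apply/eqP.
by have := brxx (x + y); rewrite brDl !brDr !brxx addr0 add0r.
Qed.

Lemma br_suml (I : Type) (r : seq I) (P : pred I) (G : I -> 'rV[F]_n) y :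
  br (\sum_(i <- r | P i) G i) y = \sum_(i <- r | P i) br (G i) y.
Proof. exact: (big_morph (br^~ y) (fun u v => brDl u v y) (br0l y)). Qed.

Lemma br_sumr (I : Type) (r : seq I) (P : pred I) (G : I -> 'rV[F]_n) x :
  br x (\sum_(i <- r | P i) G i) = \sum_(i <- r | P i) br x (G i).
Proof. exact: (big_morph (br x) (brDr x) (br0r x)). Qed.

Lemma jacobi x y z : br x (br y z) = br (br x y) z + br y (br x z).
Proof.
case: (bracketP br) => _ _ _ J; have := J x y z.
rewrite [br z (br x y)]brC [br z x]brC brNr => /eqP.
by rewrite -addrA addr_eq0 opprD !opprK addrC => /eqP.
Qed.

Lemma mul_ad x y : y *m ad br x = br x y.
Proof.
rewrite [in RHS](row_sum_delta y) br_sumr; apply/rowP=> i.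
by rewrite mxE summxE; apply: eq_bigr => j _; rewrite brZr !mxE.
Qed.

Lemma adP x (A : 'M[F]_n) : (forall y, br x y = y *m A) -> ad br x = A.
Proof. by move=> H; apply/row_matrixP => i; rewrite !rowE mul_ad H. Qed.

Lemma adD x y : ad br (x + y) = ad br x + ad br y.
Proof. by apply: adP => z; rewrite mulmxDr !mul_ad brDl. Qed.

Lemma adZ a x : ad br (a *: x) = a *: ad br x.
Proof. by apply: adP => z; rewrite -scalemxAr mul_ad brZl. Qed.

Lemma adN x : ad br (- x) = - ad br x.
Proof. by rewrite -scaleN1r adZ scaleN1r. Qed.

Lemma adB x y : ad br (x - y) = ad br x - ad br y.
Proof. by rewrite adD adN. Qed.

Lemma ad0 : ad br 0 = 0.
Proof. by rewrite -(scale0r 0) adZ scale0r. Qed.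

Lemma ad_br x y : ad br (br x y) = ad br y *m ad br x - ad br x *m ad br y.
Proof.
by apply: adP => z; rewrite mulmxBr !mulmxA !mul_ad jacobi addrK.
Qed.

Lemma ad_comm x y : br x y = 0 -> ad br x *m ad br y = ad br y *m ad br x.
Proof. by move=> xy; apply/esym/eqP; rewrite -subr_eq0 -ad_br xy ad0. Qed.

Lemma brs_subP A B C :
  (forall x y, (x <= A)%MS -> (y <= B)%MS -> (br x y <= C)%MS) <->
  (brs br A B <= C)%MS.
Proof.
split=> [H|H x y /submxP [u ->] /submxP [v ->]].
  apply/sumsmx_subP => i _; apply/sumsmx_subP => j _.
  by rewrite genmxE H ?row_sub.
rewrite !mulmx_sum_row br_suml summx_sub // => i _.
rewrite br_sumr summx_sub // => j _; rewrite brZl brZr !scalemx_sub //.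
apply: submx_trans H; rewrite -[X in (X <= _)%MS]/(br (row i A) (row j B)).
rewrite -(genmxE (br _ _)); apply: (sumsmx_sup i) => //.
exact: (sumsmx_sup j).
Qed.

Lemma mem_brs A B x y : (x <= A)%MS -> (y <= B)%MS -> (br x y <= brs br A B)%MS.
Proof. by apply: (proj2 (brs_subP A B _)). Qed.

Lemma brs_mul A B C M :
  (forall x y, (x <= A)%MS -> (y <= B)%MS -> (br x y *m M <= C)%MS) ->
  (brs br A B *m M <= C)%MS.
Proof.
move=> H; rewrite sumsmxMr; apply/sumsmx_subP => i _.
rewrite sumsmxMr; apply/sumsmx_subP => j _.
by rewrite (eqmxMr M (genmxE _)) H ?row_sub.
Qed.

Lemma brs_ind A B (Q : 'rV[F]_n -> Prop) :
  Q 0 -> (forall u v, Q u -> Q v -> Q (u + v)) -> (forall a u, Q u -> Q (a *: u)) ->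
  (forall x y, (x <= A)%MS -> (y <= B)%MS -> Q (br x y)) ->
  forall v, (v <= brs br A B)%MS -> Q v.
Proof.
move=> Q0 QD QZ Qb v /sub_sumsmxP [u ->].
elim/big_rec: _ => // i w _ Qw; apply: (QD) => //.
have : (u i *m (\sum_(j < n) <<br (row i A) (row j B)>>)%MS
        <= \sum_(j < n) <<br (row i A) (row j B)>>)%MS by exact: submxMl.
case/sub_sumsmxP=> t ->; elim/big_rec: _ => // j w' _ Qw'; apply: QD => //.
have : (t j *m <<br (row i A) (row j B)>>%MS <= br (row i A) (row j B))%MS.
  by rewrite (submx_trans (submxMl _ _)) ?genmxE.
by case/sub_rVP=> a ->; apply/QZ/Qb; apply: row_sub.
Qed.

Lemma brs_mono A B C D : (A <= C)%MS -> (B <= D)%MS -> (brs br A B <= brs br C D)%MS.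
Proof.
move=> AC BD; apply/brs_subP => x y xA yB.
by apply: mem_brs; [apply: submx_trans AC | apply: submx_trans BD].
Qed.

Definition derivation (D : 'M[F]_n) : Prop :=
  forall x y, br x y *m D = br (x *m D) y + br x (y *m D).

Lemma derivation_ad x : derivation (ad br x).
Proof. by move=> y z; rewrite !mul_ad jacobi. Qed.

(** On a bracket, D - (a + b) acts as D - a on one factor plus D - b on the other, so each
    application lowers i + j. *)
Lemma derivation_gev (D : 'M[F]_n) a b i j x y : derivation D ->
  x *m (D - a%:M) ^+ i = 0 -> y *m (D - b%:M) ^+ j = 0 ->
  br x y *m (D - (a + b)%:M) ^+ (i + j) = 0.
Proof.
move=> derD; move Ek: (i + j)%N => k; elim: k i j x y Ek => [|k IHk] i j x y Ek.
  move/eqP: Ek; rewrite addn_eq0 => /andP [/eqP -> /eqP ->].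
  by rewrite !expr0 !mulmx1 => -> _; rewrite br0l.
move=> xi yj; rewrite exprS -mulmxE mulmxA.
have -> : br x y *m (D - (a + b)%:M) = br (x *m (D - a%:M)) y + br x (y *m (D - b%:M)).
  rewrite !mulmxBr derD !mul_mx_scalar brBl brBr brZl brZr scalerDl opprD.
  by rewrite addrACA.
rewrite mulmxDl; case: i Ek xi => [|i] Ek xi.
  move: xi; rewrite expr0 mulmx1 => ->; rewrite mul0mx !br0l !mul0mx.
  by rewrite addr0.
case: j Ek yj => [|j] Ek yj.
  move: yj; rewrite expr0 mulmx1 => ->; rewrite mul0mx !br0r !mul0mx.
  by rewrite addr0.
have xi' : x *m (D - a%:M) *m (D - a%:M) ^+ i = 0.
  by rewrite -mulmxA mulmxE -exprS.
have yj' : y *m (D - b%:M) *m (D - b%:M) ^+ j = 0.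
  by rewrite -mulmxA mulmxE -exprS.
rewrite (IHk i j.+1) ?add0r //; last by apply: succn_inj; rewrite -Ek.
by rewrite (IHk i.+1 j) //; apply: succn_inj; rewrite -Ek addnS.
Qed.

Lemma ad_derivation x D : derivation D ->
  ad br (x *m D) = ad br x *m D - D *m ad br x.
Proof.
by move=> derD; apply: adP => y; rewrite mulmxBr !mulmxA !mul_ad derD addrK.
Qed.

Definition kf x y : F := \tr (ad br x *m ad br y).

Lemma kfC x y : kf x y = kf y x.
Proof. exact: mxtrace_mulC. Qed.

Lemma kfDl x y z : kf (x + y) z = kf x z + kf y z.
Proof. by rewrite /kf adD mulmxDl mxtraceD. Qed.

Lemma kfZl a x y : kf (a *: x) y = a * kf x y.
Proof. by rewrite /kf adZ -scalemxAl mxtraceZ. Qed.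

Lemma kfNl x y : kf (- x) y = - kf x y.
Proof. by rewrite -scaleN1r kfZl mulN1r. Qed.

Lemma kfDr x y z : kf x (y + z) = kf x y + kf x z.
Proof. by rewrite kfC kfDl !(kfC x). Qed.

Lemma kfZr a x y : kf x (a *: y) = a * kf x y.
Proof. by rewrite kfC kfZl (kfC x). Qed.

Lemma kfNr x y : kf x (- y) = - kf x y.
Proof. by rewrite kfC kfNl (kfC x). Qed.

Lemma kf0l x : kf 0 x = 0.
Proof. by rewrite /kf ad0 mul0mx mxtrace0. Qed.

Lemma kf0r x : kf x 0 = 0.
Proof. by rewrite kfC kf0l. Qed.

Lemma kf_sumr (I : Type) (r : seq I) (P : pred I) (G : I -> 'rV[F]_n) x :
  kf x (\sum_(i <- r | P i) G i) = \sum_(i <- r | P i) kf x (G i).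
Proof. exact: (big_morph (kf x) (kfDr x) (kf0r x)). Qed.

Lemma kf_inv x y z : kf (br x y) z = kf x (br y z).
Proof.
rewrite /kf !ad_br mulmxBl mulmxBr !raddfB /= -!mulmxA; congr (_ - _).
by rewrite mxtrace_mulC mulmxA.
Qed.

Lemma kf_skew x y z : kf (br x y) z = - kf y (br x z).
Proof. by rewrite brC kfNl kf_inv. Qed.

Lemma kf_comm_nilp x y k : br x y = 0 -> ad br x ^+ k = 0 -> kf x y = 0.
Proof. by move=> /ad_comm cxy xk; apply: mxtrace_comm_nilp xk. Qed.

Definition gram : 'M[F]_n := \matrix_(i, j) kf (delta_mx 0 i) (delta_mx 0 j).

Lemma kfE x y : kf x y = (x *m gram *m y^T) 0 0.
Proof.
have kfd i z : kf (delta_mx 0 i) z = (row i gram *m z^T) 0 0.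
  rewrite {1}(row_sum_delta z) kf_sumr mxE; apply: eq_bigr => j _.
  by rewrite kfZr !mxE mulrC.
rewrite {1}(row_sum_delta x) kfC kf_sumr [x *m gram]mulmx_sum_row mulmx_suml summxE.
by apply: eq_bigr => i _; rewrite kfZr kfC kfd -scalemxAl [in RHS]mxE.
Qed.

(** The form is that of the whole algebra restricted to U, not the Killing form of U itself. *)
Definition nondeg U : Prop :=
  forall x, (x <= U)%MS -> (forall y, (y <= U)%MS -> kf x y = 0) -> x = 0.

Lemma kf_proj U x : nondeg U ->
  exists2 x1, (x1 <= U)%MS & forall y, (y <= U)%MS -> kf (x - x1) y = 0.
Proof.
move=> ndU; pose B := row_base U; pose G := B *m gram *m B^T.
have Gu : G \in unitmx.
  rewrite -row_free_unit -kermx_eq0; apply/rowV0P => w /sub_kermxP wG.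
  apply: (row_free_inj (row_base_free U)); rewrite mul0mx; apply: ndU.
    by rewrite (submx_trans (submxMl _ _)) // eq_row_base.
  move=> y; rewrite -(eq_row_base U) => /submxP [v ->].
  rewrite kfE [(v *m _)^T]trmx_mul.
  have -> : w *m B *m gram *m (B^T *m v^T) = w *m G *m v^T by rewrite /G !mulmxA.
  by rewrite wG mul0mx mxE.
exists (x *m gram *m B^T *m invmx G *m B).
  by rewrite (submx_trans (submxMl _ _)) // eq_row_base.
move=> y; rewrite -(eq_row_base U) => /submxP [v ->]; rewrite -/B.
rewrite kfE !mulmxBl [(v *m B)^T]trmx_mul.
set X := x *m gram *m B^T.
have -> : X *m invmx G *m B *m gram *m (B^T *m v^T) = x *m gram *m (B^T *m v^T).
  have -> : X *m invmx G *m B *m gram *m (B^T *m v^T) = X *m (invmx G *m G) *m v^T.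
    by rewrite /G !mulmxA.
  by rewrite mulVmx // mulmx1 /X !mulmxA.
by rewrite subrr mxE.
Qed.

Lemma nondeg_gram : nondeg 1%:M -> gram \in unitmx.
Proof.
move=> nd1; rewrite -row_free_unit -kermx_eq0; apply/rowV0P => w /sub_kermxP wG.
by apply: nd1 (submx1 _) _ => y _; rewrite kfE wG mul0mx mxE.
Qed.

(** Let z represent the functional x -> tr(D ad x). The derivation E = D - ad z is then
    trace-orthogonal to all ad x, and kf(xE, y) is, by cyclicity, the trace of E against an ad of a
    bracket, hence 0. *)
Lemma derivation_inner D : nondeg 1%:M -> derivation D -> exists z, D = ad br z.
Proof.
move=> nd1 derD.
pose t := \row_i \tr (D *m ad br (delta_mx 0 i)).
have tE x : \tr (D *m ad br x) = (t *m x^T) 0 0.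
  rewrite {1}(row_sum_delta x) mxE.
  rewrite (big_morph (ad br) adD ad0) mulmx_sumr raddf_sum /=.
  by apply: eq_bigr => i _; rewrite adZ -scalemxAr mxtraceZ !mxE mulrC.
pose z := t *m invmx gram; exists z.
have zE x : kf z x = \tr (D *m ad br x).
  by rewrite tE kfE /z mulmxKV // nondeg_gram.
pose E := D - ad br z.
have derE : derivation E.
  move=> x y; rewrite !mulmxBr derD derivation_ad brBl brBr opprD.
  by rewrite addrACA.
have trE x : \tr (E *m ad br x) = 0.
  by rewrite mulmxBl raddfB /= -zE subrr.
have adE x : ad br (x *m E) = ad br x *m E - E *m ad br x := ad_derivation x derE.
suff E0 : E = 0 by apply/eqP; rewrite -subr_eq0; apply/eqP.
apply/row_matrixP => i; rewrite rowE row0; apply: nd1 (submx1 _) _ => y _.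
set x := delta_mx 0 i; rewrite /kf adE; move: E {derE adE} trE => E trE.
rewrite mulmxBl raddfB /=.
rewrite -mulmxA mxtrace_mulC -!mulmxA -raddfB /= -mulmxBr.
by rewrite -ad_br trE.
Qed.

(** Additivity of g is asked only when a + b is again listed, since otherwise the two eigenspaces
    have zero bracket. Taking g = id gives the semisimple part, taking a rational functional gives
    the derivation of Cartan's criterion. *)
Lemma derivation_of_spectral D S rs P (g : F -> F) : derivation D ->
  spectral D n rs P ->
  (forall (w : 'rV[F]_n) b j, b \in rs -> w *m (D - b%:M) ^+ j = 0 -> w *m S = g b *: w) ->
  (forall a b, a \in rs -> b \in rs -> a + b \in rs -> g (a + b) = g a + g b) ->
  derivation S.
Proof.
move=> derD sD SE gD u v; have [Urs s1 PD] := sD.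
have Pw (w : 'rV[F]_n) a : a \in rs ->
    w *m horner_mx D (P a) *m (D - a%:M) ^+ n = 0.
  by move=> ars; rewrite -mulmxA PD ?mulmx0.
have Huv a b : a \in rs -> b \in rs ->
    let u' := u *m horner_mx D (P a) in let v' := v *m horner_mx D (P b) in
    br u' v' *m S = br (u' *m S) v' + br u' (v' *m S).
  move=> ars brs u' v'; have := derivation_gev derD (Pw u a ars) (Pw v b brs).
  rewrite -/u' -/v' => Hab.
  rewrite (SE _ _ _ ars (Pw u a ars)) (SE _ _ _ brs (Pw v b brs)) brZl brZr -scalerDl.
  have [abrs|abrs] := boolP (a + b \in rs); first by rewrite -gD // (SE _ _ _ abrs Hab).
  by rewrite (spectral_notin sD Hab abrs) mul0mx scaler0.
have {}Huv a : a \in rs -> let u' := u *m horner_mx D (P a) in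
    br u' v *m S = br (u' *m S) v + br u' (v *m S).
  move=> ars u'; rewrite (spectralE sD v) mulmx_suml !br_sumr mulmx_suml -big_split.
  by apply: eq_big_seq => b brs; apply: Huv.
rewrite (spectralE sD u) [X in br X v + _]mulmx_suml !br_suml mulmx_suml -big_split.
by apply: eq_big_seq => a ars; apply: Huv.
Qed.

Lemma ad_jordan x : nondeg 1%:M -> exists s m, [/\ x = s + m,
  (exists p, ad br s = horner_mx (ad br x) p), sdiag (ad br s), ad br m ^+ n = 0 &
  forall k (W : 'M[F]_(k, n)) b j,
    W *m (ad br x - b%:M) ^+ j = 0 -> W *m ad br s = b *: W].
Proof.
move=> nd1; have [S [N [xSN Sp Sd Nn SE]]] := jordan (ad br x).
have [rs [P sA]] := spectral_ex (ad br x).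
have derS : derivation S.
  apply: (derivation_of_spectral (g := id) (derivation_ad x) sA) => //.
  by move=> w b j _; apply: SE.
have [s Es] := derivation_inner nd1 derS.
exists s, (x - s); rewrite addrC subrK adB -Es; split=> //.
by rewrite xSN addrC addKr.
Qed.

(** Skewness makes the kernel orthogonal to all eigenspaces of nonzero eigenvalue, so a vector of
    the kernel orthogonal to the kernel is orthogonal to U. *)
Lemma nondeg_ker U D : nondeg U -> sdiag D -> (U *m D <= U)%MS ->
  (forall x y, kf (x *m D) y = - kf x (y *m D)) -> nondeg (U :&: kermx D)%MS.
Proof.
move=> ndU /sdiag_spectral [rs [P sD]] UD skD x.
rewrite sub_capmx => /andP [xU /sub_kermxP xD] Hx; apply: ndU => // y yU.
have [_ _ PD] := sD.
rewrite (spectralE sD y) kf_sumr big_seq big1 // => a ars.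
set y' := y *m _.
have y'U : (y' <= U)%MS by apply: spectral_stable.
have y'D : y' *m D = a *: y'.
  apply/eqP; rewrite -subr_eq0 -mul_mx_scalar -mulmxBr -[D - _]expr1.
  by rewrite -mulmxA PD ?mulmx0.
have [a0|a0] := eqVneq a 0.
  apply: Hx; rewrite sub_capmx y'U; apply/sub_kermxP.
  by rewrite y'D a0 scale0r.
apply: (mulfI a0); rewrite mulr0 -kfZr -y'D; apply: oppr_inj.
by rewrite -skD xD kf0l oppr0.
Qed.

Lemma nondeg_fix U D : nondeg U -> sdiag D -> (U *m D <= U)%MS ->
  (forall x y, kf (x *m D) (y *m D) = kf x y) -> nondeg (U :&: kermx (D - 1%:M))%MS.
Proof.
move=> ndU /sdiag_spectral [rs [P sD]] UD isoD x.
rewrite sub_capmx => /andP [xU /sub_kermxP xD] Hx; apply: ndU => // y yU.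
have [_ _ PD] := sD.
rewrite (spectralE sD y) kf_sumr big_seq big1 // => a ars.
set y' := y *m _.
have y'U : (y' <= U)%MS by apply: spectral_stable.
have y'D : y' *m (D - a%:M) = 0.
  by rewrite -[D - _]expr1 -mulmxA PD ?mulmx0.
have [a1|a1] := eqVneq a 1.
  apply: Hx; rewrite sub_capmx y'U; apply/sub_kermxP.
  by rewrite -y'D a1.
have a10 : a - 1 != 0 by rewrite subr_eq0.
apply: (mulfI a10); rewrite mulr0 mulrBl mul1r -kfZr.
move/eqP: y'D; rewrite mulmxBr subr_eq0 mul_mx_scalar => /eqP <-.
move/eqP: xD; rewrite mulmxBr subr_eq0 mulmx1 => /eqP {1}<-.
by rewrite isoD subrr.
Qed.

(** The image of a skew map is the orthogonal of its kernel; in coordinates skewness reads M G = - G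
    M^T with G the Gram matrix. *)
Lemma im_ad_perp x w : nondeg 1%:M ->
  (forall z, br x z = 0 -> kf w z = 0) -> exists y, w = br x y.
Proof.
move=> nd1 Hw; set M := ad br x.
have entry (A : 'M[F]_n) i j : A i j =
      ((delta_mx 0 i : 'rV[F]_n) *m A *m (delta_mx 0 j : 'rV[F]_n)^T) 0 0.
    by rewrite -rowE trmx_delta -colE !mxE.
have MG : M *m gram = - (gram *m M^T).
  apply/matrixP => i j; rewrite [LHS]entry [RHS]entry mulmxN mulNmx [RHS]mxE.
  have := kf_skew x (delta_mx 0 i) (delta_mx 0 j).
  by rewrite -!mul_ad !kfE trmx_mul !mulmxA.
have wG : (w *m gram <= M^T)%MS.
  rewrite submxE; have : ((cokermx M^T)^T <= kermx M)%MS.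
    by apply/sub_kermxP/trmx_inj; rewrite trmx_mul trmxK mulmx_coker trmx0.
  move=> sK; apply/eqP/rowP => j; rewrite !mxE.
  have zK : (row j (cokermx M^T)^T <= kermx M)%MS by apply: submx_trans (row_sub _ _) sK.
  have := Hw _ _; move/(_ (row j (cokermx M^T)^T)).
  rewrite -mul_ad (sub_kermxP zK) => /(_ erefl); rewrite kfE => {2}<-.
  by rewrite tr_row trmxK mxE; apply: eq_bigr => i _; rewrite !mxE.
have /submxP [v vM] := wG.
have Gu := nondeg_gram nd1.
exists (- v *m invmx gram); rewrite -mul_ad -/M.
have -> : M = - (gram *m M^T) *m invmx gram by rewrite -MG mulmxK.
move: M^T vM => N vM; rewrite mulmxA mulmxN mulNmx mulmxA mulmxKV // !mulNmx opprK.
by rewrite -vM mulmxK.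
Qed.

End Bracket.

(** * Engel's theorem and Cartan's criterion *)

Lemma submodule_matrix (K : fieldType) (N : nat) (R : 'rV[K]_N -> Prop) :
  R 0 -> (forall u v, R u -> R v -> R (u + v)) -> (forall a u, R u -> R (a *: u)) ->
  exists A : 'M[K]_N, forall v, (v <= A)%MS <-> R v.
Proof.
move=> R0 RD RZ.
have [|A RA maxA] := @ex_maxP _ (fun A : 'M[K]_N => \rank A) N
    (fun A => forall v, (v <= A)%MS -> R v) _ (fun A _ => rank_leq_row A).
  by exists 0 => v; rewrite submx0 => /eqP ->.
exists A => v; split; first exact: RA.
move=> Rv; have AAv : (A <= A + <<v>>)%MS by apply: addsmxSl.
have : (\rank (A + <<v>>)%MS <= \rank A)%N.
  apply: maxA => w /sub_addsmxP [[s t] /= ->]; apply: RD.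
    by apply: RA; apply: submxMl.
  have : (t *m <<v>>%MS <= v)%MS by rewrite (submx_trans (submxMl _ _)) ?genmxE.
  by case/sub_rVP => a ->; apply: RZ.
rewrite (geq_leqif (mxrank_leqif_sup AAv)).
by move=> H; apply: submx_trans H; rewrite (submx_trans _ (addsmxSr _ _)) ?genmxE.
Qed.

(** * Rational scalars and rational functionals in characteristic 0 *)

Section Ratr.
Variable F : fieldType.
Hypothesis ch0 : [pchar F] =i pred0.

Lemma intr_eq0_pchar (k : int) : (k%:~R == 0 :> F) = (k == 0).
Proof.
case: k => k; first by rewrite (proj1 (pcharf0P F) ch0).
by rewrite NegzE rmorphN oppr_eq0 /= (proj1 (pcharf0P F) ch0).
Qed.

Lemma ratr_pchar_div (a b : int) : b != 0 ->
  ratr (a%:~R / b%:~R) = a%:~R / b%:~R :> F.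
Proof.
move=> b0; set x := _ / _ : rat; have d0 := denq_neq0 x.
have E : numq x * b = a * denq x.
  apply: (@intr_inj rat); rewrite !intrM; apply/eqP.
  by rewrite -eqr_div ?intr_eq0 // divq_num_den.
rewrite /ratr; apply/eqP; rewrite eqr_div ?intr_eq0_pchar //.
by rewrite -!intrM E.
Qed.

Lemma ratr_pcharD (x y : rat) : ratr (x + y) = ratr x + ratr y :> F.
Proof.
have dx := denq_neq0 x; have dy := denq_neq0 y.
have -> : x + y = (numq x * denq y + numq y * denq x)%:~R / (denq x * denq y)%:~R.
  rewrite -{1}(divq_num_den x) -{1}(divq_num_den y) addf_div ?intr_eq0 //.
  by rewrite !(intrD, intrM).
rewrite ratr_pchar_div ?mulf_neq0 // /ratr addf_div ?intr_eq0_pchar //.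
by rewrite !(intrD, intrM).
Qed.

Lemma ratr_pcharM (x y : rat) : ratr (x * y) = ratr x * ratr y :> F.
Proof.
have dx := denq_neq0 x; have dy := denq_neq0 y.
have -> : x * y = (numq x * numq y)%:~R / (denq x * denq y)%:~R.
  rewrite -{1}(divq_num_den x) -{1}(divq_num_den y) mulf_div.
  by rewrite !intrM.
by rewrite ratr_pchar_div ?mulf_neq0 // /ratr mulf_div !intrM.
Qed.

(* Orthogonality to all rational relations among the [l i] is what makes
   [l i |-> phi i] extend to a Q-linear functional. *)
Lemma rational_functionals_vanish (N : nat) (l : 'I_N -> F) (m : 'I_N -> nat) :
  (forall i, 0 < m i)%N ->
  (forall phi : 'I_N -> rat,
     (forall c : 'I_N -> rat, \sum_i ratr (c i) * l i = 0 -> \sum_i c i * phi i = 0) ->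
     \sum_i ratr (phi i) * (l i * (m i)%:R) = 0) ->
  forall i, l i = 0.
Proof.
move=> m0 Hphi.
have ratr0 : ratr 0 = 0 :> F by exact: (ratr_int F 0).
have [||| A RA] := @submodule_matrix rat N (fun v => \sum_i ratr (v 0 i) * l i = 0).
- by rewrite big1 // => i _; rewrite mxE ratr0 mul0r.
- move=> u v u0 v0.
  rewrite (eq_bigr (fun i => ratr (u 0 i) * l i + ratr (v 0 i) * l i)).
    by rewrite big_split /= u0 v0 addr0.
  by move=> i _; rewrite mxE ratr_pcharD mulrDl.
- move=> a u u0; rewrite (eq_bigr (fun i => ratr a * (ratr (u 0 i) * l i))).
    by rewrite -mulr_sumr u0 mulr0.
  by move=> i _; rewrite mxE ratr_pcharM mulrA.
have kA0 : kermx A^T == 0.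
  apply/rowV0P => w /sub_kermxP wA.
  have orth c : \sum_i ratr (c i) * l i = 0 -> \sum_i c i * w 0 i = 0.
    move=> c0; pose v := \row_i c i.
    have /submxP [u vuA] : (v <= A)%MS.
      by apply/RA; rewrite -[RHS]c0; apply: eq_bigr => i _; rewrite mxE.
    have vw : v *m w^T = 0.
      by rewrite vuA -mulmxA -[A]trmxK -trmx_mul wA trmx0 mulmx0.
    have := congr1 (fun M : 'M_1 => M 0 0) vw; rewrite [LHS]mxE [RHS]mxE => vw0; rewrite -[RHS]vw0.
    by apply: eq_bigr => i _; rewrite !mxE.
  (* The functional w is admissible, so the hypothesis makes (w_i m_i) a rational relation; pairing
     it with w gives sum m_i w_i^2 = 0 over the rationals, hence w = 0. *)
  have /orth : \sum_i ratr (w 0 i * (m i)%:R) * l i = 0.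
    rewrite -[RHS](Hphi _ orth); apply: eq_bigr => i _.
    by rewrite ratr_pcharM ratr_nat -mulrA [_ * l i]mulrC.
  move/eqP; rewrite psumr_eq0 => [/allP H|i _]; last first.
    by rewrite mulrAC -expr2 mulr_ge0 ?sqr_ge0 ?ler0n.
  apply/rowP => i; have := H i (mem_index_enum i); rewrite mxE.
  by rewrite mulrAC !mulf_eq0 pnatr_eq0 eqn0Ngt m0 orbF orbb => /eqP.
have Afull : row_full A by rewrite /row_full -mxrank_tr -[_ == _]/(row_free A^T) -kermx_eq0.
move=> i; have /RA : ((delta_mx 0 i : 'rV[rat]_N) <= A)%MS by apply: submx_full.
rewrite (bigD1 i) //= big1 ?addr0 => [|j ji]; rewrite !mxE ?eqxx /=.
  by rewrite (ratr_nat F 1) mul1r.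
by rewrite (negPf ji) ratr0 mul0r.
Qed.

End Ratr.

Section Cartan.
Variables (F : closedFieldType) (n' : nat).
Local Notation n := n'.+1.
Variable br : lieBracket F n.
Implicit Types (x y z u v w : 'rV[F]_n) (A B C K U W I : 'M[F]_n).

(** Relative form: a vector of W, nonzero modulo U, killed by K modulo U. Induction on dim K: a
    maximal proper subalgebra K', acting on K modulo K', yields x normalizing K', and the induction
    hypothesis for K' on W modulo U yields a starting vector. *)
Lemma engel K U W : subalgebra br K ->
  (forall x, (x <= K)%MS -> ad br x ^+ n = 0) ->
  (brs br K U <= U)%MS -> (brs br K W <= W)%MS -> ~~ (W <= U)%MS ->
  exists w, [/\ (w <= W)%MS, ~~ (w <= U)%MS & forall x, (x <= K)%MS -> (br x w <= U)%MS].
Proof.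
move: {2}(\rank K).+1 (leqnn (\rank K).+1) => r.
elim: r K U W => // r IHr K U W Kr Ka Kn KU KW WU.
have [K0|K0] := eqVneq K 0.
  have /row_subPn [i Wi] := WU; exists (row i W); rewrite row_sub; split=> // x.
  by rewrite K0 submx0 => /eqP ->; rewrite br0l sub0mx.
have [||K' [K'a K'K KK'] maxK'] := @ex_maxP _ (fun A : 'M[F]_n => \rank A) n
    (fun A => [/\ subalgebra br A, (A <= K)%MS & ~~ (K <= A)%MS]).
- exists 0; rewrite sub0mx submx0; split=> //.
  by apply/brs_subP => x y; rewrite submx0 => /eqP ->; rewrite br0l sub0mx.
- by move=> A _; apply: rank_leq_row.
have K'r : (\rank K' < r)%N.
  apply: (leq_trans _ (ltnSE Kr)); rewrite ltn_neqAle mxrankS // andbT.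
  apply: contra KK' => /eqP rE; by rewrite -(geq_leqif (mxrank_leqif_sup K'K)) rE.
have K'n x : (x <= K')%MS -> ad br x ^+ n = 0.
  by move=> xK'; apply/Kn/(submx_trans xK').
have sK' A B : (brs br K A <= B)%MS -> (brs br K' A <= B)%MS.
  by apply: submx_trans; apply: brs_mono.
have [x [xK xK' K'x]] := IHr K' K' K K'r K'a K'n K'a (sK' _ _ Ka) KK'.
(* Since x normalizes K', the sum is a subalgebra, and maximality of K' makes it all of K. *)
have KE : (K <= K' + <<x>>)%MS.
  apply: contraT => nK; have : (\rank (K' + <<x>>)%MS <= \rank K')%N.
    apply: maxK'; split=> //; last by rewrite addsmx_sub K'K genmxE.
    apply/brs_subP => y z /sub_addsmxP [[y1 y2] /= ->] /sub_addsmxP [[z1 z2] /= ->].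
    have [a ->] : exists a, y2 *m <<x>>%MS = a *: x.
      by apply/sub_rVP; rewrite (submx_trans (submxMl _ _)) ?genmxE.
    have [b ->] : exists b, z2 *m <<x>>%MS = b *: x.
      by apply/sub_rVP; rewrite (submx_trans (submxMl _ _)) ?genmxE.
    have yK' := submxMl y1 K'; have zK' := submxMl z1 K'.
    apply: submx_trans (addsmxSl _ _).
    rewrite !(brDl, brDr, brZl, brZr) brxx !scaler0 addr0 brC.
    rewrite !addmx_sub ?eqmx_opp ?scalemx_sub ?K'x //.
      exact: (proj2 (brs_subP _ _ _ _) K'a).
    by rewrite brC eqmx_opp K'x.
  rewrite (geq_leqif (mxrank_leqif_sup (addsmxSl _ _))) => H.
  case/negP: xK'; apply: submx_trans H; rewrite (submx_trans _ (addsmxSr _ _)) ?genmxE //.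
have [w [wW wU K'w]] := IHr K' U W K'r K'a K'n (sK' _ _ KU) (sK' _ _ KW) WU.
pose X j := w *m ad br x ^+ j.
have XS j : X j.+1 = br x (X j) by rewrite /X exprSr -mulmxE mulmxA mul_ad.
have XW j : (X j <= W)%MS.
  elim: j => [|j IHj]; first by rewrite /X expr0 mulmx1.
  by rewrite XS (proj2 (brs_subP _ _ _ _) KW).
have XU j y : (y <= K')%MS -> (br y (X j) <= U)%MS.
  elim: j y => [|j IHj] y yK'; first by rewrite /X expr0 mulmx1 K'w.
  rewrite XS jacobi addmx_sub ?IHj ?K'x //.
  by apply: (proj2 (brs_subP _ _ _ _) KU) => //; apply: IHj.
(* Nilpotency of ad x lets the chain of w enter U; the last term outside U is killed modulo U by x
   and still by K'. *)
have [j XjU XSjU] : exists2 j, ~~ (X j <= U)%MS & (X j.+1 <= U)%MS.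
  have ex : exists j, (X j <= U)%MS.
    by exists n; rewrite /X Kn // mulmx0 sub0mx.
  case: (ex_minnP ex) => [[|j]]; first by rewrite /X expr0 mulmx1 (negPf wU).
  move=> XU' minj; exists j => //; apply/negP => /minj; by rewrite ltnn.
exists (X j); split=> // y yK; have /sub_addsmxP [[y1 y2] /= ->] := submx_trans yK KE.
have [a ->] : exists a, y2 *m <<x>>%MS = a *: x.
  by apply/sub_rVP; rewrite (submx_trans (submxMl _ _)) ?genmxE.
rewrite brDl brZl addmx_sub ?scalemx_sub -?XS //.
by apply/XU/submxMl.
Qed.

(** If K is nonzero, a maximal proper ideal U of K has a one-dimensional complement killed by K
    modulo U, so [K, K] lies in U and K is not perfect. *)
Lemma engel_perfect K : subalgebra br K ->
  (forall x, (x <= K)%MS -> ad br x ^+ n = 0) -> (K <= brs br K K)%MS -> K = 0.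
Proof.
move=> Ka Kn Kp; apply/eqP; apply: contraT => K0.
have [||U [UK KU nKU] maxU] := @ex_maxP _ (fun A : 'M[F]_n => \rank A) n
    (fun A => [/\ (A <= K)%MS, (brs br K A <= A)%MS & ~~ (K <= A)%MS]).
- exists 0; rewrite sub0mx; split=> //; last by rewrite submx0.
  by apply/brs_subP => x y _; rewrite submx0 => /eqP ->; rewrite br0r sub0mx.
- by move=> A _; apply: rank_leq_row.
have [w [wK wU Kw]] := engel Ka Kn KU Ka nKU.
have Uw : (U + <<w>> <= K)%MS by rewrite addsmx_sub UK genmxE.
have UwU : (brs br K (U + <<w>>)%MS <= U)%MS.
  apply/brs_subP => x y xK /sub_addsmxP [[y1 y2] /= ->].
  have [a ->] : exists a, y2 *m <<w>>%MS = a *: w.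
    by apply/sub_rVP; rewrite (submx_trans (submxMl _ _)) ?genmxE.
  rewrite brDr brZr addmx_sub ?scalemx_sub ?Kw //.
  by apply: (proj2 (brs_subP _ _ _ _) KU) => //; apply: submxMl.
case: (boolP (K <= U + <<w>>)%MS) => [KE|nK].
  case/negP: nKU; apply: submx_trans Kp (submx_trans _ UwU).
  exact: brs_mono.
have : (\rank (U + <<w>>)%MS <= \rank U)%N.
  by apply: maxU; split=> //; apply: submx_trans UwU (addsmxSl _ _).
rewrite (geq_leqif (mxrank_leqif_sup (addsmxSl _ _))) => H.
by case/negP: wU; apply: submx_trans H; rewrite (submx_trans _ (addsmxSr _ _)) ?genmxE.
Qed.

Lemma ideal_derived Q I : ideal_in br Q I -> ideal_in br Q (brs br I I).
Proof.
move=> [IQ QI]; have sQI := proj2 (brs_subP _ _ _ _) QI; split.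
  apply/brs_subP => x y xI yI; apply: (submx_trans _ IQ).
  by apply: (sQI) => //; apply: (submx_trans xI IQ).
apply/brs_subP => x v xQ; move: v; apply: brs_ind => [|u v Hu Hv|a u Hu|u v uI vI].
- by rewrite br0r sub0mx.
- by rewrite brDr addmx_sub.
- by rewrite brZr scalemx_sub.
by rewrite jacobi addmx_sub // mem_brs // sQI.
Qed.

Lemma ideal_in_derived Q I k : ideal_in br Q I -> ideal_in br Q (derived br I k).
Proof. by move=> QI; elim: k => //= k; apply: ideal_derived. Qed.

Lemma ideal_derived_sub Q I : ideal_in br Q I -> (brs br I I <= I)%MS.
Proof.
move=> [IQ QI]; apply: submx_trans QI; exact: brs_mono.
Qed.

Lemma derived_stable Q I : ideal_in br Q I ->
  exists k, (derived br I k <= derived br I k.+1)%MS.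
Proof.
move=> QI; apply: NNPP => nostab.
have H k : (\rank (derived br I k) + k <= n)%N.
  elim: k => [|k IHk]; first by rewrite addn0 rank_leq_row.
  apply: leq_trans IHk; rewrite addnS ltn_add2r.
  have sk := ideal_derived_sub (ideal_in_derived k QI).
  rewrite ltn_neqAle mxrankS // andbT; apply/negP => /eqP rE; apply: nostab; exists k.
  by rewrite -(geq_leqif (mxrank_leqif_sup sk)) rE.
by have := H n.+1; rewrite addnS ltnNge leq_addl.
Qed.

Lemma sum_delta (R : pzRingType) N (i : 'I_N) (g : 'I_N -> R) :
  \sum_t (t == i)%:R * g t = g i.
Proof.
rewrite (bigD1 i) //= eqxx mul1r big1 ?addr0 // => t /negPf ->.
by rewrite mul0r.
Qed.

(** Core of Cartan's criterion. Since x lies in [P, P] and P in the radical, tr(D ad x) = 0 for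
    every derivation D. The D used replaces the eigenvalues of ad x by the values of a rational
    functional on them, which takes the place of complex conjugation. *)
Lemma nilpotent_of_radical x P : (x <= brs br P P)%MS ->
  (forall y z, (y <= P)%MS -> kf br y z = 0) -> ad br x ^+ n = 0.
Proof.
move=> xP Prad.
have trS D : derivation br D -> \tr (D *m ad br x) = 0.
  move=> derD; move: x xP.
  apply: brs_ind => [|u v Hu Hv|a u Hu|u v uP vP].
  - by rewrite ad0 mulmx0 mxtrace0.
  - by rewrite adD mulmxDr mxtraceD Hu Hv addr0.
  - by rewrite adZ -scalemxAr mxtraceZ Hu mulr0.
  rewrite ad_br mulmxBr raddfB /= !mulmxA [X in X - _]mxtrace_mulC mulmxA -raddfB /=.
  by rewrite -mulmxBl -(ad_derivation _ derD) -/(kf br _ _) kfC Prad.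
(* Only eigenvalues with nonzero projection are kept, so that the multiplicities, given by ranks,
   are positive. *)
have [rs0 [p /spectral_filter sA]] := spectral_ex (ad br x).
move: sA; set rs := filter _ _ => sA; have [Urs s1 PA] := sA.
set E := fun a => horner_mx (ad br x) (p a).
pose N := size rs; pose l (i : 'I_N) := nth 0 rs i.
have lP a : a \in rs -> exists i, a = l i.
  move=> ars; have ia : (index a rs < N)%N by rewrite index_mem.
  by exists (Ordinal ia); rewrite /l /= nth_index.
suff l0 : forall i, l i = 0.
  rewrite -[_ ^+ _]mul1mx -s1 mulmx_suml big_seq big1 // => a ars.
  have [i ai] := lP a ars; have := PA a ars.
  by rewrite {2}ai l0 raddf0 subr0.
apply: (rational_functionals_vanish (bracket_pchar br) (m := fun i => \rank (E (l i)))).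
  move=> i; rewrite lt0n mxrank_eq0.
  by have := mem_nth 0 (ltn_ord i); rewrite -/(l i) mem_filter => /andP [].
move=> phi Hphi.
pose g a : F := if insub (index a rs) is Some i then ratr (phi i) else 0.
have gl i : g (l i) = ratr (phi i).
  by rewrite /g /l index_uniq // valK.
pose S := \sum_(a <- rs) g a *: E a.
have derS : derivation br S.
  apply: (derivation_of_spectral (g := g) (derivation_ad br x) sA).
    move=> w b j brs wb; rewrite /S mulmx_sumr (bigD1_seq b) //= big_seq_cond big1 ?addr0.
      by rewrite -scalemxAr (spectral_proj sA wb) ?eqxx.
    move=> a /andP [ars ab]; rewrite -scalemxAr (spectral_proj sA wb) //.
    by rewrite (negPf ab) scaler0.
  move=> a b /lP [i ->] /lP [j ->] /lP [k ijk]; rewrite ijk !gl.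
  (* Coefficients of the relation l_i + l_j - l_k = 0, which [phi] must respect; indices may
     coincide, hence the sum of indicators. *)
  pose c t : int := (t == i)%:R + (t == j)%:R - (t == k)%:R.
  have cE (R : pzRingType) t : (c t)%:~R = (t == i)%:R + (t == j)%:R - (t == k)%:R :> R.
    by rewrite /c rmorphB rmorphD /= !mulrz_nat.
  have : \sum_t (c t)%:~R * phi t = 0.
    apply: Hphi; under eq_bigr do rewrite ratr_int cE mulrBl mulrDl.
    by rewrite sumrB big_split /= !sum_delta ijk subrr.
  under eq_bigr do rewrite cE mulrBl mulrDl.
  rewrite sumrB big_split /= !sum_delta => /eqP.
  by rewrite subr_eq0 => /eqP <-; rewrite ratr_pcharD //; exact: bracket_pchar br.
rewrite -[RHS](trS S derS) /S mulmx_suml raddf_sum (big_nth 0) big_mkord.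
apply: eq_bigr => i _; rewrite -/(l i) -scalemxAl /= mxtraceZ gl.
by rewrite (spectral_trace sA) // mem_nth.
Qed.

(** The derived series of the radical S of the form stabilizes at a perfect ideal. Its elements are
    ad-nilpotent by Cartan's argument, so Engel makes it 0; thus S is a solvable ideal. *)
Theorem killing_nondeg : semisimple_lie br 1%:M -> nondeg br 1%:M.
Proof.
move=> ss; pose S := kermx (gram br).
have SP y z : (y <= S)%MS -> kf br y z = 0.
  by move=> /sub_kermxP yS; rewrite kfE yS mul0mx mxE.
have PS x : (forall y, kf br x y = 0) -> (x <= S)%MS.
  move=> Hx; apply/sub_kermxP/rowP => j; rewrite [RHS]mxE -[RHS](Hx (delta_mx 0 j)) kfE.
  by rewrite trmx_delta -colE [RHS]mxE.
have Sid : ideal_in br 1%:M S.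
  split; first exact: submx1.
  apply/brs_subP => x y _ yS; apply: PS => z.
  by rewrite kf_skew SP ?oppr0.
have [k Hk] := derived_stable Sid.
have Pid := ideal_in_derived k Sid.
suff P0 : derived br S k = 0.
  have S0 : (S <= (0 : 'M[F]_n))%MS by apply: ss => //; exists k; rewrite P0 sub0mx.
  move=> x _ Hx; apply/eqP; rewrite -submx0; apply: submx_trans S0; apply: PS => y.
  exact/Hx/submx1.
have PS' : (derived br S k <= S)%MS.
  elim: k {Hk Pid} => //= k IHk; apply: submx_trans (ideal_derived_sub Sid).
  exact: brs_mono.
apply: engel_perfect => //; first exact: ideal_derived_sub Pid.
move=> x xP; apply: (nilpotent_of_radical (P := derived br S k)).
  exact: submx_trans Hk.
by move=> y z yP; apply: SP; apply: submx_trans PS'.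
Qed.

End Cartan.

(** * Diagonalizability of ad h for an sl2-triple *)

Section GenEigen.
Variables (F : closedFieldType) (n' : nat).
Local Notation n := n'.+1.
Implicit Types (A B D X : 'M[F]_n) (a b c : F).

Lemma gev_inj m (W : 'M[F]_(m, n)) A a b i j : a != b ->
  W *m (A - a%:M) ^+ i = 0 -> W *m (A - b%:M) ^+ j = 0 -> W = 0.
Proof.
move=> ab; rewrite -!horner_mx_XsubCn.
exact: coprime_kill (coprime_XsubCn i j ab).
Qed.

Lemma gev_im (w : 'rV[F]_n) A a j : a != 0 -> w *m (A - a%:M) ^+ j = 0 ->
  exists w', w = w' *m A.
Proof.
move=> a0 wa; have a0' : 0 != a by rewrite eq_sym.
have [[u v] /= uv1] := Bezout_eq1_coprimepP _ _ (coprime_XsubCn 1 j a0').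
exists (w *m horner_mx A u).
have H : w *m horner_mx A (u * ('X - 0%:P) ^+ 1 + v * ('X - a%:P) ^+ j) = w.
  by rewrite uv1 horner_mx1 mulmx1.
rewrite -{1}H rmorphD /= [v * _]mulrC !horner_mxM mulmxDr !mulmxA !horner_mx_XsubCn.
by rewrite wa mul0mx addr0 expr1 raddf0 subr0.
Qed.

Lemma iota_notin (N : nat) (rs : seq F) (g : nat -> F) : injective g -> (size rs <= N)%N ->
  exists2 k, (k <= N)%N & g k \notin rs.
Proof.
move=> ginj sN; apply: NNPP => H.
have : (size [seq g k | k <- iota 0 N.+1] <= size rs)%N.
  apply: uniq_leq_size; first by rewrite map_inj_uniq ?iota_uniq.
  move=> x /mapP [k]; rewrite mem_iota add0n ltnS /= => kN ->.
  by apply: contraT => gk; exfalso; apply: H; exists k.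
by rewrite size_map size_iota ltnNge sN.
Qed.

(** X carries the generalized eigenspace of [a] into that of [a + c], and in characteristic 0 the
    progression a + kc soon leaves the finite spectrum. *)
Lemma shift_nilpotent A X c : [pchar F] =i pred0 -> c != 0 ->
  X *m A = A *m X + c *: X -> exists k, X ^+ k = 0.
Proof.
move=> ch0 c0 XA; have [rs [P [Urs s1 PA]]] := spectral_ex A.
have sA : spectral A n rs P by [].
exists (size rs); rewrite -[_ ^+ _]mul1mx -s1 mulmx_suml big_seq big1 // => a ars.
have sh (W : 'M[F]_n) b j : W *m (A - b%:M) ^+ j = 0 -> W *m X *m (A - (b + c)%:M) ^+ j = 0.
  move=> Wb; have -> : W *m X *m (A - (b + c)%:M) ^+ j = W *m (A - b%:M) ^+ j *m X.
    rewrite -!mulmxA; congr (W *m _); elim: j {Wb} => [|j IHj].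
      by rewrite !expr0 mul1mx mulmx1.
    rewrite exprS -mulmxE mulmxA.
    have -> : X *m (A - (b + c)%:M) = (A - b%:M) *m X.
      rewrite mulmxBr mulmxBl XA mul_mx_scalar mul_scalar_mx scalerDl.
      by rewrite [b *: X + _]addrC opprD addrA addrK.
    by rewrite -mulmxA IHj exprS -mulmxE mulmxA.
  by rewrite Wb mul0mx.
have gk k : horner_mx A (P a) *m X ^+ k *m (A - (a + k%:R * c)%:M) ^+ n = 0.
  elim: k => [|k IHk]; first by rewrite expr0 mulmx1 mul0r addr0 PA.
  rewrite exprSr -mulmxE mulmxA -[k.+1%:R]natr1 mulrDl mul1r addrA.
  exact: sh.
have [|k ks kn] := @iota_notin (size rs) rs (fun k => a + k%:R * c) _ (leqnn _).
  by move=> i j /addrI /(mulIf c0); apply: natr_pchar_inj.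
by apply: (mulmx_expr0 ks); apply: (spectral_notin sA (gk k)) kn.
Qed.

End GenEigen.

Section Sl2.
Variables (F : closedFieldType) (n' : nat).
Local Notation n := n'.+1.
Variable br : lieBracket F n.
Implicit Types (x y z u v w : 'rV[F]_n) (a b c : F).

Lemma ad_nilpotent_eigen x y c : c != 0 -> br x y = c *: y ->
  exists k, ad br y ^+ k = 0.
Proof.
move=> c0 xy; apply: (shift_nilpotent (A := ad br x) (bracket_pchar br) c0).
by rewrite -adZ -xy ad_br addrC subrK.
Qed.

Variables e h f : 'rV[F]_n.
Hypothesis sl2 : sl2_triple br e h f.
Hypothesis en : nilpotent_elt br e.
Hypothesis nd1 : nondeg br 1%:M.

Let he : br h e = 2%:R *: e. Proof. by case: sl2. Qed.
Let hf : br h f = - 2%:R *: f. Proof. by case: sl2 => _ -> _; rewrite scaleNr. Qed.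
Let ef : br e f = h. Proof. by case: sl2. Qed.

Let two0 : (2%:R : F) != 0. Proof. exact: natr_neq0 br 1. Qed.

(* On the lowering chain of [v] one has e f^(k+1) v = (k+1) (h + k) f^k v,
   and h + k is invertible on the generalized weight space of weight nu - 2k. *)
Lemma fe_injective v nu j : v *m (ad br h - nu%:M) ^+ j = 0 ->
  (forall k, nu != k%:R) -> br f (br e v) = 0 -> v = 0.
Proof.
move=> vnu nuN fev; pose w k := v *m ad br f ^+ k.
have wS k : w k.+1 = br f (w k) by rewrite /w exprSr -mulmxE mulmxA mul_ad.
have hw k : br h (br f (w k)) = br f (br h (w k)) - 2%:R *: br f (w k).
  by rewrite jacobi hf brZl scaleNr addrC.
have ew k : br e (w k.+1) = k.+1%:R *: (br h (w k) + k%:R *: w k).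
  elim: k => [|k IHk].
    by rewrite wS /w expr0 mulmx1 jacobi ef fev addr0 scale0r addr0 scale1r.
  rewrite wS jacobi ef IHk brZr brDr brZr -wS.
  have -> : br f (br h (w k)) = br h (w k.+1) + 2%:R *: w k.+1.
    by rewrite wS hw subrK.
  by apply/rowP => i; rewrite !mxE; ring.
have gw k : exists i, w k *m (ad br h - (nu - (2 * k)%:R)%:M) ^+ i = 0.
  elim: k => [|k [i Hi]]; first by exists j; rewrite muln0 subr0 /w expr0 mulmx1.
  exists (1 + i)%N; rewrite wS.
  have -> : nu - (2 * k.+1)%:R = - 2%:R + (nu - (2 * k)%:R).
    by rewrite mulnS natrD opprD addrCA.
  apply: derivation_gev Hi; first exact: derivation_ad.
  by rewrite expr1 mulmxBr mul_ad hf mul_mx_scalar subrr.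
have wk k : w k.+1 = 0 -> w k = 0.
  move=> wk0; have [i Hi] := gw k; have := ew k; rewrite wk0 br0r => /esym /eqP.
  rewrite scaler_eq0 (negPf (natr_neq0 br k)) /= => /eqP hk.
  apply: (gev_inj (a := - k%:R) (i := 1) _ _ Hi); last first.
    by rewrite expr1 mulmxBr mul_ad mul_mx_scalar scaleNr opprK.
  apply: contra (nuN k); rewrite -subr_eq0 => /eqP E; rewrite -subr_eq0 -oppr_eq0 -[X in _ == X]E.
  by rewrite natrM; apply/eqP; ring.
have [|k fk] := ad_nilpotent_eigen (x := h) (y := f) (c := - 2%:R) _ hf.
  by rewrite oppr_eq0.
suff : w 0%N = 0 by rewrite /w expr0 mulmx1.
have : w k = 0 by rewrite /w fk mulmx0.
by elim: k {fk} => // k IHk /wk.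
Qed.

Lemma weight_shift x v a b j : br h x = a *: x ->
  v *m (ad br h - b%:M) ^+ j = 0 -> exists i, br x v *m (ad br h - (a + b)%:M) ^+ i = 0.
Proof.
move=> hx vb; exists (1 + j)%N; apply: derivation_gev vb; first exact: derivation_ad.
by rewrite expr1 mulmxBr mul_ad hx mul_mx_scalar subrr.
Qed.

Lemma natr_neqN2 k : (- 2%:R : F) != k%:R.
Proof.
apply/eqP => /eqP; rewrite eq_sym -subr_eq0 opprK -natrD addn2.
by rewrite (negPf (natr_neq0 br _)).
Qed.

Lemma ker_e_weightN2 x : br e x = 0 -> br h x = - 2%:R *: x -> x = 0.
Proof.
move=> ex hx; apply: (fe_injective (j := 1) _ natr_neqN2).
  by rewrite expr1 mulmxBr mul_ad hx mul_mx_scalar subrr.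
by rewrite ex br0r.
Qed.

(** The vector [f, x] is killed by e and has the negative weight -2. Hence the centralizer of the
    triple can be described by e and h alone. *)
Lemma centralize_e_h x : br e x = 0 -> br h x = 0 -> br f x = 0.
Proof.
move=> ex hx; apply: ker_e_weightN2; first by rewrite jacobi ef hx ex br0r addr0.
by rewrite jacobi hf hx br0r addr0 brZl.
Qed.

(** Reduce to [h, [h, z]] = 0. Then [h, z] is centralized by the triple, so f e f z = f h z = 0,
    injectivity of f e at weight -2 gives f z = 0, and h z = e f z vanishes. *)
Lemma ker_e_weight0 z j : br e z = 0 -> z *m ad br h ^+ j = 0 -> br h z = 0.
Proof.
elim: j z => [|[|j] IHj] z ez zj.
- by move: zj; rewrite expr0 mulmx1 => ->; rewrite br0r.
- by move: zj; rewrite expr1 mul_ad.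
have eh v : br e v = 0 -> br e (br h v) = 0.
  by move=> ev; rewrite jacobi [br e h]brC he ev br0r addr0 brNl brZl ev scaler0 oppr0.
have hhz : br h (br h z) = 0.
  by apply: IHj; rewrite ?eh // -mul_ad -mulmxA mulmxE -exprS.
have fhz : br f (br h z) = 0 by apply: centralize_e_h => //; apply: eh.
have [i fzi] : exists i, br f z *m (ad br h - (- 2%:R)%:M) ^+ i = 0.
  have [|i] := @weight_shift f z (- 2%:R) 0 j.+2 hf; first by rewrite raddf0 subr0.
  by rewrite addr0; exists i.
have fz : br f z = 0.
  apply: (fe_injective fzi natr_neqN2).
  by rewrite [br e _]jacobi ef ez br0r addr0.
have : br e (br f z) = 0 by rewrite fz br0r.
by rewrite jacobi ef ez br0r addr0.
Qed.

(** The nilpotent Jordan part m of h commutes with e, h and f. If m = [e, y], then y may be taken of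
    weight -2, and [f, [e, y]] = [f, m] = 0 forces y = 0. *)
Lemma ad_h_sdiag : sdiag (ad br h).
Proof.
have [s [m [hsm _ Sd Nm SE]]] := ad_jordan h nd1.
suff m0 : m = 0 by rewrite hsm m0 addr0.
have mE : m = h - s by rewrite hsm addrAC subrr add0r.
have SE1 x a : br h x = a *: x -> br s x = a *: x.
  move=> hx; rewrite -mul_ad; apply: (SE _ _ _ 1%N).
  by rewrite expr1 mulmxBr mul_ad hx mul_mx_scalar subrr.
have me : br e m = 0 by rewrite brC mE brBl he (SE1 _ _ he) subrr oppr0.
have mf : br f m = 0 by rewrite brC mE brBl hf (SE1 _ _ hf) subrr oppr0.
have hm : br h m = 0.
  rewrite mE brBr brxx sub0r brC opprK.
  by have := @SE1 h 0; rewrite brxx scale0r => ->.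
have [rs [P sA]] := spectral_ex (ad br h); have [Urs s1 PA] := sA.
set E := fun a => horner_mx (ad br h) (P a).
have gE w a : a \in rs -> w *m E a *m (ad br h - a%:M) ^+ n = 0.
  by move=> ars; rewrite -mulmxA PA ?mulmx0.
(* m is orthogonal to the kernel of ad e: at nonzero weight because such vectors lie in the image of
   ad h and [h, m] = 0, at weight 0 because they commute with the nilpotent m. *)
have [z ez|y my] := im_ad_perp (x := e) (w := m) nd1.
  rewrite (spectralE sA z) kf_sumr big_seq big1 // => a ars; set za := z *m _.
  have eza : br e za = 0.
    rewrite -mul_ad; apply/sub_kermxP; apply: (spectral_stable) => //.
      apply: mulmx_subP => v /sub_kermxP; rewrite mul_ad => ev; apply/sub_kermxP.
      by rewrite !mul_ad jacobi [br e h]brC he ev br0r brNl brZl ev scaler0 oppr0 addr0.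
    by apply/sub_kermxP; rewrite mul_ad.
  have : za *m (ad br h - a%:M) ^+ n = 0 := gE z a ars.
  move: za eza => za eza; have [->|a0] := eqVneq a 0 => gza; last first.
    have [w ->] := gev_im a0 gza.
    by rewrite mul_ad -[LHS]opprK -kf_skew hm kf0l oppr0.
  have hza : br h za = 0.
    by apply: (ker_e_weight0 (j := n) eza); move: gza; rewrite raddf0 subr0.
  apply: kf_comm_nilp Nm; rewrite mE brBl hza.
  by have := @SE1 za 0; rewrite hza scale0r => ->; rewrite ?subrr.
have m0g : m *m (ad br h - 0%:M) ^+ 1 = 0 by rewrite raddf0 subr0 expr1 mul_ad.
have [rs0|/(spectral_notin sA m0g) //] := boolP (0 \in rs).
have gey a : a \in rs -> exists i, br e (y *m E a) *m (ad br h - (2%:R + a)%:M) ^+ i = 0.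
  by move=> ars; apply: weight_shift he (gE y a ars).
have mEy : m = \sum_(a <- rs) if 2%:R + a == 0 then br e (y *m E a) else 0.
  have {1}-> : m = m *m E 0 by rewrite (spectral_proj sA m0g) ?eqxx.
  rewrite {1}my {1}(spectralE sA y) br_sumr mulmx_suml; apply: eq_big_seq => a ars.
  by have [i ai] := gey a ars; rewrite (spectral_proj sA ai) // eq_sym.
have [N2|N2] := boolP (- 2%:R \in rs); last first.
  rewrite mEy big_seq big1 // => a ars; case: eqP => // /eqP.
  by rewrite addrC addr_eq0 => /eqP aE; rewrite -aE ars in N2.
have mE2 : m = br e (y *m E (- 2%:R)).
  rewrite {1}mEy (bigD1_seq (- 2%:R)) //= subrr eqxx big1 ?addr0 // => a aN.
  by rewrite addrC addr_eq0 (negPf aN).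
have y0 : y *m E (- 2%:R) = 0.
  by apply: (fe_injective (gE y _ N2) natr_neqN2); rewrite -mE2.
by rewrite mE2 y0 br0r.
Qed.

(** The last nonzero vector of the raising chain of v is killed by e; a non-integral weight would
    contradict injectivity of f e there. *)
Lemma ad_h_eigenvalue v a : v != 0 -> br h v = a *: v -> exists j : int, a = j%:~R.
Proof.
move=> v0 hv; pose w k := v *m ad br e ^+ k.
have wS k : w k.+1 = br e (w k) by rewrite /w exprSr -mulmxE mulmxA mul_ad.
have hw k : br h (w k) = (a + (2 * k)%:R) *: w k.
  elim: k => [|k IHk]; first by rewrite muln0 addr0 /w expr0 mulmx1.
  rewrite wS jacobi he IHk brZl brZr -scalerDl; congr (_ *: _).
  by rewrite mulnS natrD addrCA.
have ex : exists k, w k == 0 by have [k ek] := en; exists k; rewrite /w ek mulmx0.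
case: (ex_minnP ex) => [[|k]] wk mink.
  by move: wk; rewrite /w expr0 mulmx1 (negPf v0).
have wk0 : w k != 0 by apply/negP => /mink; rewrite ltnn.
apply: NNPP => nint; case/negP: wk0; apply/eqP.
apply: (fe_injective (nu := a + (2 * k)%:R) (j := 1)).
- by rewrite expr1 mulmxBr mul_ad hw mul_mx_scalar subrr.
- move=> i; apply/eqP => ai; apply: nint; exists (i%:Z - (2 * k)%:Z).
  by rewrite rmorphB /= -!pmulrn -ai addrK.
by rewrite -wS (eqP wk) br0r.
Qed.

End Sl2.

(** * The grading and its automorphism *)

Lemma prim_root_pchar0 (F : closedFieldType) m : [pchar F] =i pred0 -> (0 < m)%N ->
  exists z : F, m.-primitive_root z.
Proof.
move=> ch0 m0; pose p : {poly F} := 'X^m - 1.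
have [r Dp] := closed_field_poly_normal p; move: Dp.
rewrite (monicP _) ?monicXnsubC // scale1r => Dp.
have rn1 : all m.-unity_root r by apply/allP=> z; rewrite -root_prod_XsubC -Dp.
have sz_r : (m < (size r).+1)%N.
  by rewrite -(size_prod_XsubC r id) -Dp size_XnsubC.
have [|z] := hasP (has_prim_root m0 rn1 _ sz_r); last by exists z.
rewrite -separable_prod_XsubC -Dp separable_Xn_sub_1 //.
by rewrite (proj1 (pcharf0P F) ch0) -lt0n.
Qed.

Section Grading.
Variables (F : closedFieldType) (n' : nat).
Local Notation n := n'.+1.
Variable br : lieBracket F n.
Implicit Types (x y z u v w : 'rV[F]_n) (a b c : F).

Lemma mem_grade Q h j x :
  (x <= grade br Q h j)%MS = (x <= Q)%MS && (br h x == j%:~R *: x).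
Proof.
rewrite sub_capmx; congr (_ && _); rewrite -mul_ad.
by apply/eigenspaceP/eqP.
Qed.

Lemma kf_weight h x y a b : a + b != 0 -> br h x = a *: x -> br h y = b *: y ->
  kf br x y = 0.
Proof.
move=> ab hx hy; apply: (mulfI ab).
by rewrite mulr0 mulrDl -kfZl -kfZr -hx -hy kf_skew addNr.
Qed.

Variables (e h f : 'rV[F]_n) (d : nat).
Hypothesis sl2 : sl2_triple br e h f.
Hypothesis en : nilpotent_elt br e.
Hypothesis nd1 : nondeg br 1%:M.
Hypothesis e0 : e != 0.
Hypothesis hd : is_depth br 1%:M h d.

Let he : br h e = 2%:R *: e. Proof. by case: sl2. Qed.

Let intr0 (k : int) : ((k%:~R : F) == 0) = (k == 0).
Proof. exact: intr_eq0_pchar (bracket_pchar br) k. Qed.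

Lemma intr_pchar_inj : injective (fun k : int => k%:~R : F).
Proof.
by move=> i j /eqP; rewrite -subr_eq0 -rmorphB /= intr0 subr_eq0 => /eqP.
Qed.

Lemma weight_le x (j : int) : x != 0 -> br h x = j%:~R *: x -> j <= d%:Z.
Proof.
move=> x0 hx; rewrite leNgt; apply/negP => dj.
have := proj2 hd j dj; rewrite submx0 => /eqP gj.
by case/negP: x0; rewrite -submx0 -gj mem_grade submx1 hx eqxx.
Qed.

Lemma depth_ge2 : (2 <= d)%N.
Proof. by have := @weight_le e 2%:Z e0 he. Qed.

(** [is_depth] bounds weights from above only; the Killing form pairs weight j with weight -j and
    supplies the lower bound. *)
Lemma weight_ge x (j : int) : x != 0 -> br h x = j%:~R *: x -> - d%:Z <= j.
Proof.
move=> x0 hx; rewrite leNgt; apply/negP => dj; case/negP: x0; apply/eqP.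
apply: nd1 (submx1 _) _ => y _.
have [rs [P sH]] := sdiag_spectral (ad_h_sdiag sl2 nd1); have [_ _ PH] := sH.
rewrite (spectralE sH y) kf_sumr big_seq big1 // => a ars; set y' := y *m _.
have [->|y'0] := eqVneq y' 0; first exact: kf0r.
have hy' : br h y' = a *: y'.
  apply/eqP; rewrite -subr_eq0 -mul_ad -mul_mx_scalar -mulmxBr -[_ - _]expr1.
  by rewrite -mulmxA PH ?mulmx0.
have [k ak] := ad_h_eigenvalue sl2 en y'0 hy'.
apply: (kf_weight _ hx hy'); rewrite ak -rmorphD intr0.
have := @weight_le y' k y'0; rewrite hy' ak => /(_ erefl) kd.
by apply/eqP => jk; lia.
Qed.

(** Weights are indexed with a shift by d, so that the range from -d to d becomes the indices 0 to
    2d of [wts]. *)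
Definition wt (j : nat) : F := (j%:Z - d%:Z)%:~R.
Definition wts : seq nat := iota 0 (2 * d).+1.

Lemma wt_inj : injective wt.
Proof. by move=> i j /intr_pchar_inj; lia. Qed.

Lemma weight_wt x (j : int) : x != 0 -> br h x = j%:~R *: x ->
  exists2 i, i \in wts & j = i%:Z - d%:Z.
Proof.
move=> x0 hx; have j1 := weight_le x0 hx; have j2 := weight_ge x0 hx.
exists `|(j + d%:Z)%R|%N; last by lia.
by rewrite mem_iota; lia.
Qed.

Lemma h_spectral : exists P, spectral (ad br h) 1 [seq wt j | j <- wts] P.
Proof.
apply: spectral_of_kill; first by rewrite (map_inj_uniq wt_inj) iota_uniq.
have [rs [P sH]] := sdiag_spectral (ad_h_sdiag sl2 nd1); have [_ s1 PH] := sH.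
set Q := \prod_(_ <- _) _.
rewrite -[horner_mx _ _]mul1mx -s1 mulmx_suml big_seq big1 // => a ars.
apply/row_matrixP => i; rewrite row0 row_mul; set y := row i _.
have [->|y0] := eqVneq y 0; first by rewrite mul0mx.
have hy : br h y = a *: y.
  apply/eqP; rewrite -subr_eq0 -mul_ad -mul_mx_scalar -mulmxBr -[_ - _]expr1.
  by rewrite [y]rowE -mulmxA PH ?mulmx0.
have [k ak] := ad_h_eigenvalue sl2 en y0 hy; rewrite ak in hy.
have [j jw kj] := weight_wt y0 hy.
rewrite /Q big_map (big_rem j) //= expr1 horner_mxM mulmxA.
have -> : y *m horner_mx (ad br h) ('X - (wt j)%:P) = 0.
  have := horner_mx_XsubCn (ad br h) (wt j) 1; rewrite !expr1 => ->.
  by rewrite mulmxBr mul_ad hy mul_mx_scalar /wt kj subrr.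
by rewrite mul0mx.
Qed.

(* With zeta a primitive root of order d+2, the automorphism zeta^(ad h)
   encodes the Z/(d+2)-grading for which cyclic elements are homogeneous. *)
Lemma grading_automorphism : exists zeta sigma, [/\ d.+2.-primitive_root zeta,
  (forall x y, br x y *m sigma = br (x *m sigma) (y *m sigma)),
  sigma \in unitmx,
  horner_mx sigma (\prod_(a <- [seq zeta ^+ i | i <- iota 0 d.+2]) ('X - a%:P)) = 0 &
  (forall x, x *m sigma = x <-> br h x = 0) /\
  (forall x, br h x = (- d%:Z)%:~R *: x -> (e + x) *m sigma = zeta ^+ 2 *: (e + x))].
Proof.
have [z prz] := prim_root_pchar0 (bracket_pchar br) (isT : 0 < d.+2)%N.
have [P sH] := h_spectral; have [Uw s1 PH] := sH.
pose E j := horner_mx (ad br h) (P (wt j)).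
(* Index j has weight j - d, which is j + 2 modulo d + 2: this is zeta^(ad h) without negative
   exponents. *)
pose s := \sum_(j <- wts) z ^+ (j + 2) *: E j.
have EE x : x = \sum_(j <- wts) x *m E j by rewrite {1}(spectralE sH x) big_map.
have Eh x j : j \in wts -> br h (x *m E j) = wt j *: (x *m E j).
  move=> jw; apply/eqP; rewrite -subr_eq0 -mul_ad -mul_mx_scalar -mulmxBr -[_ - _]expr1.
  by rewrite -mulmxA PH ?mulmx0 ?map_f.
have Ew w j k : j \in wts -> br h w = wt k *: w -> w *m E j = if j == k then w else 0.
  move=> jw hw; rewrite (spectral_proj sH (b := wt k) (j := 1)) ?map_f //.
    by rewrite (inj_eq wt_inj).
  by rewrite expr1 mulmxBr mul_ad hw mul_mx_scalar subrr.
have sE w j : j \in wts -> br h w = wt j *: w -> w *m s = z ^+ (j + 2) *: w.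
  move=> jw hw; rewrite /s mulmx_sumr (bigD1_seq j) ?iota_uniq //= big_seq_cond big1 ?addr0.
    by rewrite -scalemxAr (Ew w j j) // eqxx.
  move=> k /andP [kw kj]; rewrite -scalemxAr (Ew w k j) // (negPf kj).
  by rewrite scaler0.
have zd2 : z ^+ d.+2 = 1 := prim_expr_order prz.
have dge2 := depth_ge2.
have sbr x y : br x y *m s = br (x *m s) (y *m s).
  have hom i j : i \in wts -> j \in wts -> let u := x *m E i in let v := y *m E j in
      br u v *m s = br (u *m s) (v *m s).
    move=> iw jw u v; have hu : br h u = wt i *: u := Eh x i iw.
    have hv : br h v = wt j *: v := Eh y j jw.
    rewrite (sE u i iw hu) (sE v j jw hv) brZl brZr scalerA -exprD.
    have [->|uv0] := eqVneq (br u v) 0; first by rewrite mul0mx scaler0.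
    have huv : br h (br u v) = (i%:Z - d%:Z + (j%:Z - d%:Z))%:~R *: br u v.
      by rewrite jacobi hu hv brZl brZr -scalerDl rmorphD.
    have [k kw kE] := weight_wt uv0 huv.
    rewrite kE in huv; rewrite (sE _ k kw huv).
    have -> : (i + 2 + (j + 2) = k + 2 + d.+2)%N by lia.
    by rewrite (exprD z (k + 2)) zd2 mulr1.
  have {}hom i : i \in wts -> let u := x *m E i in br u y *m s = br (u *m s) (y *m s).
    move=> iw u; rewrite {1}(EE y) {2}(EE y) mulmx_suml !br_sumr mulmx_suml.
    by apply: eq_big_seq => j jw; apply: hom.
  rewrite {1}(EE x) {2}(EE x) mulmx_suml !br_suml mulmx_suml.
  by apply: eq_big_seq => i iw; apply: hom.
have sComp x j : j \in wts -> x *m s *m E j = z ^+ (j + 2) *: (x *m E j).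
  move=> jw; rewrite {1}(EE x) !mulmx_suml (bigD1_seq j) ?iota_uniq //=.
  rewrite big_seq_cond big1 ?addr0 => [|k /andP [kw kj]].
    by rewrite (sE _ _ jw (Eh x j jw)) -scalemxAl (Ew _ _ _ jw (Eh x j jw)) eqxx.
  rewrite (sE _ _ kw (Eh x k kw)) -scalemxAl (Ew _ _ _ jw (Eh x k kw)).
  by rewrite eq_sym (negPf kj) scaler0.
have z0 k : z ^+ k != 0.
  rewrite expf_neq0 //; apply/eqP => zz; move: zd2.
  by rewrite zz exprS mul0r => /esym/eqP; rewrite oner_eq0.
exists z, s; split=> //.
- rewrite -row_free_unit -kermx_eq0; apply/rowV0P => w /sub_kermxP ws.
  rewrite (EE w) big_seq big1 // => j jw; apply/eqP.
  have := sComp w j jw; rewrite ws mul0mx => /esym /eqP.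
  by rewrite scaler_eq0 (negPf (z0 _)).
- apply/row_matrixP => i; rewrite row0 rowE (EE (delta_mx 0 i)) mulmx_suml.
  rewrite big_seq big1 // => j jw; set w := _ *m E j.
  have hw : br h w = wt j *: w := Eh _ j jw.
  rewrite big_map (big_rem ((j + 2) %% d.+2)%N) ?mem_iota ?ltn_mod //.
  rewrite horner_mxM mulmxA.
  have := horner_mx_XsubCn s (z ^+ ((j + 2) %% d.+2)) 1; rewrite !expr1 => ->.
  rewrite mulmxBr (sE w j jw hw) mul_mx_scalar (prim_expr_mod prz) subrr.
  by rewrite mul0mx.
have dw : d \in wts by rewrite mem_iota; lia.
have wtd : wt d = 0 by rewrite /wt subrr.
split=> [x|x hx].
  split=> [xs|hx].
    have xE : x = x *m E d.
      rewrite {1}(EE x) (bigD1_seq d) ?iota_uniq //= big_seq_cond big1 ?addr0 //.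
      move=> j /andP [jw jd]; have := sComp x j jw; rewrite xs => /esym /eqP.
      rewrite -subr_eq0 -[X in _ - X]scale1r -scalerBl scaler_eq0 subr_eq0.
      (* Since j + 2 ranges from 2 to 2d + 2, the only multiple of d + 2 among its values is at j =
         d, that is, at weight 0. *)
      case/orP => [|/eqP //]; rewrite -(prim_order_dvd prz) => /dvdnP [k jk].
      move: jw jd; rewrite mem_iota => jw /eqP jd; exfalso.
      by case: k jk => [|[|k]]; nia.
    by rewrite xE Eh // wtd scale0r.
  by rewrite (sE x d dw) ?wtd ?scale0r // addn2 zd2 scale1r.
have d2w : (d + 2)%N \in wts by rewrite mem_iota; lia.
have zw : 0%N \in wts by rewrite mem_iota; lia.
have wt2 : wt (d + 2) = 2%:R.
  by rewrite /wt PoszD addrC addKr.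
rewrite mulmxDl (sE e _ d2w) ?wt2 // (sE x _ zw); last by rewrite hx /wt sub0r.
have -> : (d + 2 + 2 = 2 + d.+2)%N by lia.
by rewrite exprD zd2 mulr1 scalerDr.
Qed.

End Grading.

(** * Reductive subalgebras and fixed-point-free automorphisms *)

Section Reductive.
Variables (F : closedFieldType) (n' : nat).
Local Notation n := n'.+1.
Variable br : lieBracket F n.
Implicit Types (x y z u v w X : 'rV[F]_n) (a b : F) (A B C L Q R I J : 'M[F]_n).

Lemma mem_subalgebra C x y : subalgebra br C ->
  (x <= C)%MS -> (y <= C)%MS -> (br x y <= C)%MS.
Proof. by move=> Ca; apply: (proj2 (brs_subP br C C C) Ca). Qed.

(** Polynomials in ad z commute with ad C, so their trace against ad of [C, C], in particular
    against ad z, vanishes. Thus ad z is nilpotent, and z, commuting with C, is orthogonal to C. *)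
Lemma center_cap_derived C z : subalgebra br C -> nondeg br C ->
  (z <= C)%MS -> (forall y, (y <= C)%MS -> br z y = 0) -> (z <= brs br C C)%MS -> z = 0.
Proof.
move=> Ca ndC zC zc zCC.
have zn : ad br z ^+ n = 0.
  apply: nilpotent_of_traces (bracket_pchar br) _ => p.
  set M := horner_mx _ p.
  have cM u : (u <= C)%MS -> M *m ad br u = ad br u *m M.
    by move=> uC; apply: comm_horner_mx; apply: ad_comm; apply: zc.
  move: z zCC @M cM {zC zc} => z zCC M; rewrite {}/M; move: (horner_mx _ p) => M cM.
  move: z zCC; apply: brs_ind => [|u v Hu Hv|a u Hu|u v uC vC].
  - by rewrite ad0 mulmx0 mxtrace0.
  - by rewrite adD mulmxDr mxtraceD Hu Hv addr0.
  - by rewrite adZ -scalemxAr mxtraceZ Hu mulr0.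
  rewrite ad_br mulmxBr raddfB /= !mulmxA [X in X - _]mxtrace_mulC mulmxA -cM //.
  by rewrite subrr.
by apply: ndC => // y yC; apply: kf_comm_nilp (zc y yC) zn.
Qed.

Lemma perp_derived_central C x : subalgebra br C -> nondeg br C -> (x <= C)%MS ->
  (forall y, (y <= brs br C C)%MS -> kf br x y = 0) ->
  forall y, (y <= C)%MS -> br x y = 0.
Proof.
move=> Ca ndC xC Hx y yC; apply: ndC => [|w wC]; first exact: mem_subalgebra.
by rewrite kf_inv Hx // mem_brs.
Qed.

Lemma nondeg_derived C : subalgebra br C -> nondeg br C -> nondeg br (brs br C C).
Proof.
move=> Ca ndC x xD Hx; have xC : (x <= C)%MS by apply: submx_trans Ca.
apply: (center_cap_derived Ca ndC) => //.
exact: perp_derived_central.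
Qed.

(** Orthogonal projection to [C, C] changes an element of C only by a central one, hence leaves
    brackets unchanged. *)
Lemma derived_perfect C : subalgebra br C -> nondeg br C ->
  (brs br C C <= brs br (brs br C C) (brs br C C))%MS.
Proof.
move=> Ca ndC; have ndD := nondeg_derived Ca ndC.
have dec x : (x <= C)%MS -> exists2 x1, (x1 <= brs br C C)%MS &
    forall y, (y <= C)%MS -> br x y = br x1 y.
  move=> xC; have [x1 x1D Hx] := kf_proj x ndD; exists x1 => // y yC.
  apply/eqP; rewrite -subr_eq0 -brBl; apply/eqP.
  apply: (perp_derived_central Ca ndC) => //.
  by rewrite addmx_sub ?eqmx_opp // (submx_trans x1D).
apply/brs_subP => x y xC yC.
have [x1 x1D ->] := dec x xC => //; have [y1 y1D yE] := dec y yC.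
by rewrite brC yE ?(submx_trans x1D) // -brC mem_brs.
Qed.

(** * Kreknin's argument for fixed-point-free automorphisms of finite order *)

Section Kreknin.
Variables (zeta : F) (sigma : 'M[F]_n) (m : nat).
Hypothesis prz : m.-primitive_root zeta.
Hypothesis sbr : forall x y, br x y *m sigma = br (x *m sigma) (y *m sigma).
Hypothesis skill :
  horner_mx sigma (\prod_(a <- [seq zeta ^+ i | i <- iota 0 m]) ('X - a%:P)) = 0.

Lemma prim_root_map_uniq : uniq [seq zeta ^+ i | i <- iota 0 m].
Proof.
rewrite map_inj_in_uniq ?iota_uniq // => i j; rewrite !mem_iota !add0n /= => im jm.
by move=> /eqP; rewrite (eq_prim_root_expr prz) !modn_small // => /eqP.
Qed.

(* With C_k = sum_(s >= k) [L, L_s], the relation L_0 = 0 turns L = C_k into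
   L_k = sum_(s > k) [L_(k-s), L_s], hence [L, L_k] <= C_(k+1) by Jacobi. *)
Lemma perfect_fixed_point_free L : (L *m sigma <= L)%MS -> (L <= brs br L L)%MS ->
  (brs br L L <= L)%MS ->
  (forall x, (x <= L)%MS -> x *m sigma = x -> x = 0) -> L = 0.
Proof.
move=> Ls Lp La L0.
have [|P sS] := @spectral_of_kill _ _ sigma 1 _ prim_root_map_uniq; first exact: skill.
have [_ s1 PS] := sS; pose E i := horner_mx sigma (P (zeta ^+ i)).
have EE x : x = \sum_(i <- iota 0 m) x *m E i by rewrite {1}(spectralE sS x) big_map.
have Es x i : i \in iota 0 m -> x *m E i *m sigma = zeta ^+ i *: (x *m E i).
  move=> im; apply/eqP; rewrite -subr_eq0 -mul_mx_scalar -mulmxBr -[_ - _]expr1.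
  by rewrite -mulmxA PS ?mulmx0 ?map_f.
have Ew w j k : j \in iota 0 m -> w *m sigma = zeta ^+ k *: w ->
    w *m E j = if j == k %[mod m] then w else 0.
  move=> jm ws; rewrite (spectral_proj sS (b := zeta ^+ k) (j := 1)) ?map_f //.
    by rewrite (eq_prim_root_expr prz).
  by rewrite expr1 mulmxBr ws mul_mx_scalar subrr.
have LE i x : (x <= L)%MS -> (x *m E i <= L)%MS by apply: spectral_stable.
have E0 x : (x <= L)%MS -> 0%N \in iota 0 m -> x *m E 0 = 0.
  by move=> xL m0; apply: (L0); rewrite ?LE // Es // expr0 scale1r.
pose C k := (\sum_(s < m | (k <= s)%N) brs br L (L *m E s)%R)%MS.
have mI (s : 'I_m) : (s : nat) \in iota 0 m by rewrite mem_iota /=.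
have m0 : (0 < m)%N := prim_order_gt0 prz.
have mC k x y s : s \in iota 0 m -> (k <= s)%N -> (x <= L)%MS -> (y <= L)%MS ->
    (br x (y *m E s) <= C k)%MS.
  rewrite mem_iota /= add0n => sm ks xL yL.
  by apply: (sumsmx_sup (Ordinal sm)) => //; apply: mem_brs => //; apply: submxMr.
have C1 : (L <= C 1)%MS.
  apply: submx_trans Lp _; apply/brs_subP => x y xL yL.
  rewrite (EE y) br_sumr big_seq summx_sub // => -[|s] sm; last exact: mC.
  by rewrite E0 // br0r sub0mx.
have CS k : (0 < k < m)%N -> (L <= C k)%MS -> (L <= C k.+1)%MS.
  case/andP=> k0 km LC; have kI : k \in iota 0 m by rewrite mem_iota.
  have Lk w : (w <= L)%MS -> (L *m (E k *m ad br w) <= C k.+1)%MS.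
    move=> wL; apply: submx_trans (submxMr _ LC) _; rewrite sumsmxMr.
    apply/sumsmx_subP => s ks; apply: brs_mul => x y xL /submxP [t ->].
    set yL := t *m L; have yLL : (yL <= L)%MS by apply: submxMl.
    rewrite mulmxA -/yL (EE x) br_suml !mulmx_suml big_seq summx_sub // => i im.
    have im' : (i < m)%N by move: im; rewrite mem_iota.
    set xi := x *m E i; set ys := yL *m E s.
    have hxy : br xi ys *m sigma = zeta ^+ (i + s) *: br xi ys.
      by rewrite sbr Es // Es // brZl brZr scalerA exprD.
    rewrite mulmxA (Ew _ _ _ kI hxy); case: eqP => [kis|_]; last by rewrite mul0mx sub0mx.
    have xiL : (xi <= L)%MS by apply: LE.
    have ysL : (ys <= L)%MS by apply: LE.
    have wa u v : (u <= L)%MS -> (v <= L)%MS -> (br u v <= L)%MS by apply: mem_subalgebra.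
    have [ks'|ks'] := eqVneq (s : nat) k.
      have i0 : i = 0%N.
        move/eqP: kis; rewrite ks' -[X in X == _ %[mod _]]add0n eqn_modDr.
        by rewrite mod0n modn_small // => /eqP.
      by rewrite /xi i0 E0 // ?br0l ?mul0mx ?sub0mx // mem_iota.
    have ks1 : (k < s)%N by rewrite ltn_neqAle eq_sym ks'.
    (* As s > k, the congruence forces i + s = k + m, and s < m gives i > k; so both Jacobi terms
       below fall into [C k.+1]. *)
    have ki : (k < i)%N.
      have sm := ltn_ord s.
      rewrite ltnNge; apply/negP => ik.
      move: kis; rewrite modn_small //.
      have [ism|ism] := ltnP (i + s) m; first by rewrite modn_small //; clear -ks1 ik; lia.
      have lt1 : (i + s - m < m)%N by clear -sm im' ism; lia.
      rewrite -(subnK ism) modnDr modn_small //; clear -sm im' ism ik ks1; lia.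
    rewrite mul_ad jacobi addmx_sub //; first by apply: mC => //; apply: wa.
    by rewrite brC eqmx_opp; apply: mC => //; apply: wa.
  apply: submx_trans LC _; apply/sumsmx_subP => s ks.
  move: ks; rewrite leq_eqVlt => /orP [/eqP ks|ks]; last exact: (sumsmx_sup s).
  apply/brs_subP => w y wL /submxP [t ->]; rewrite -ks.
  apply: submx_trans (Lk w wL); rewrite -mul_ad -!mulmxA.
  exact: submxMl.
have H k : (0 < k <= m)%N -> (L <= C k)%MS.
  elim: k => // -[|k] IHk // /andP [_ km]; apply: CS => //.
  by apply: IHk; exact: ltnW.
have := H m; rewrite m0 leqnn => /(_ isT); rewrite /C big_pred0.
  by rewrite submx0 => /eqP.
by move=> s; rewrite leqNgt ltn_ord.
Qed.

(** Nondegeneracy makes [R, R] perfect, which is what turns the solvability argument into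
    commutativity of R. *)
Lemma fixed_point_free_abelian R : subalgebra br R -> nondeg br R ->
  (R *m sigma <= R)%MS -> (forall x, (x <= R)%MS -> x *m sigma = x -> x = 0) ->
  forall x y, (x <= R)%MS -> (y <= R)%MS -> br x y = 0.
Proof.
move=> Ra ndR Rs R0 x y xR yR; apply/eqP; rewrite -submx0.
suff <- : brs br R R = 0 by apply: mem_brs.
apply: perfect_fixed_point_free.
- apply: brs_mul => u v uR vR; rewrite sbr mem_brs //.
    by apply: submx_trans (submxMr _ uR) Rs.
  by apply: submx_trans (submxMr _ vR) Rs.
- exact: derived_perfect.
- exact: brs_mono.
by move=> u uR; apply: R0; apply: submx_trans Ra.
Qed.

End Kreknin.

Lemma sdiag_ker (D : 'M[F]_n) (v : 'rV[F]_n) k : sdiag D -> v *m D ^+ k = 0 -> v *m D = 0.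
Proof.
move=> /sdiag_spectral [rs [P sD]] vDk; have [_ _ PD] := sD.
have vk : v *m (D - 0%:M) ^+ k = 0 by rewrite raddf0 subr0.
have [r0|/(spectral_notin sD vk) ->] := boolP (0 \in rs); last by rewrite mul0mx.
have := spectral_proj sD vk r0; rewrite eqxx => {1}<-.
by have := PD 0 r0; rewrite raddf0 subr0 expr1 -mulmxA => ->; rewrite mulmx0.
Qed.

Lemma semisimple_elt_sdiag X : semisimple_elt br 1%:M X -> sdiag (ad br X).
Proof.
move=> [k [B [a [B1 Ba]]]].
exists (undup [seq a i | i <- enum 'I_k]); first exact: undup_uniq.
set Q := \prod_(_ <- _) _.
suff BQ : B *m horner_mx (ad br X) Q = 0.
  apply/row_matrixP => i; rewrite rowE row0.
  have /submxP [u ->] : ((delta_mx 0 i : 'rV[F]_n) <= B)%MS.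
    by apply: submx_trans (submx1 _) _; case/andP: B1.
  by rewrite -mulmxA BQ mulmx0.
apply/row_matrixP => i; rewrite row_mul row0.
have /dvdpP [q ->] : 'X - (a i)%:P %| Q.
  by rewrite dvdp_XsubCl root_prod_XsubC mem_undup map_f ?mem_enum.
rewrite mulrC horner_mxM mulmxA -['X - _]expr1 horner_mx_XsubCn expr1.
by rewrite mulmxBr Ba mul_mx_scalar subrr mul0mx.
Qed.

Lemma sdiag_semisimple_elt Q X : sdiag (ad br X) -> (Q *m ad br X <= Q)%MS ->
  semisimple_elt br Q X.
Proof.
move=> /sdiag_spectral [rs [P sD]] QX; have [_ s1 PD] := sD.
pose T : finType := ('I_(size rs) * 'I_n)%type.
pose E (t : T) := horner_mx (ad br X) (P (nth 0 rs t.1)).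
pose ev (t : 'I_#|T|) : T := enum_val t.
pose B := \matrix_(t < #|T|) (row (ev t).2 Q *m E (ev t)).
exists #|T|, B, (fun t => nth 0 rs (ev t).1); split.
  apply/andP; split.
    apply/row_subP => t; rewrite rowK.
    by apply: spectral_stable => //; apply: row_sub.
  apply/row_subP => j; rewrite (spectralE sD (row j Q)) (big_nth 0) big_mkord.
  apply: summx_sub => i _.
  have -> : row j Q *m horner_mx (ad br X) (P (nth 0 rs i)) = row (enum_rank ((i, j) : T)) B.
    by rewrite rowK /ev enum_rankK.
  exact: row_sub.
move=> t; rewrite rowK; apply/eqP; rewrite -subr_eq0 -mul_mx_scalar -mulmxBr.
by rewrite -[_ - _]expr1 -mulmxA PD ?mulmx0 // mem_nth.
Qed.

(** * Semisimple elements with abelian centralizer *)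

Section RegularElement.
Variables (Q : 'M[F]_n) (X : 'rV[F]_n).
Let R := (Q :&: kermx (ad br X))%MS.
Hypothesis nd1 : nondeg br 1%:M.
Hypothesis Qa : subalgebra br Q.
Hypothesis ndQ : nondeg br Q.
Hypothesis Qp : (Q <= brs br Q Q)%MS.
Hypothesis XQ : (X <= Q)%MS.
Hypothesis Xs : sdiag (ad br X).
Hypothesis Rab : forall x y, (x <= R)%MS -> (y <= R)%MS -> br x y = 0.

Lemma stable_ad_mem : (Q *m ad br X <= Q)%MS.
Proof. by apply: mulmx_subP => v vQ; rewrite mul_ad mem_subalgebra. Qed.

Lemma nondeg_cent : nondeg br R.
Proof.
apply: nondeg_ker Xs _ _ => //; first exact: stable_ad_mem.
by move=> x y; rewrite !mul_ad kf_skew.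
Qed.

(** If y normalizes R then [y, X] lies in R, so (ad X)^2 kills y, and ad X, being diagonalizable,
    already does. *)
Lemma cartan_cent : cartan_in br Q R.
Proof.
have XR : (X <= R)%MS by rewrite sub_capmx XQ; apply/sub_kermxP; rewrite mul_ad brxx.
split.
- exact: capmxSl.
- by apply/brs_subP => x y xR yR; rewrite Rab // sub0mx.
- exists 1%N; apply/brs_subP => x y xR yR; by rewrite Rab ?sub0mx.
move=> y yQ Hy; rewrite sub_capmx yQ; apply/sub_kermxP.
have := Hy X XR; rewrite sub_capmx => /andP [_ /sub_kermxP yX].
apply: (@sdiag_ker _ _ 2) => //; apply: oppr_inj.
by rewrite expr2 -mulmxE mulmxA oppr0 -mulNmx mul_ad -brC.
Qed.

(** A nonzero solvable ideal contains a nonzero abelian ideal J, which is split into eigenspaces of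
    ad X and shown to be orthogonal to Q piece by piece. *)
Lemma semisimple_of_regular : semisimple_lie br Q.
Proof.
move=> I QI [k Ik]; apply: contraT => I0.
have [J [QJ J0 Jab]] : exists J, [/\ ideal_in br Q J, J != 0 & brs br J J = 0].
  elim: k Ik => [|k IHk] Ik; first by rewrite Ik in I0.
  have [Jk0|Jk0] := eqVneq (derived br I k) 0; first by apply: IHk; rewrite Jk0 sub0mx.
  exists (derived br I k); split=> //; first exact: ideal_in_derived.
  by apply/eqP; rewrite -submx0.
have [JQ sQJ] := QJ; have {}sQJ := proj2 (brs_subP _ _ _ _) sQJ.
have {}Jab x y : (x <= J)%MS -> (y <= J)%MS -> br x y = 0.
  by move=> xJ yJ; apply/eqP; rewrite -submx0 -Jab mem_brs.
have JX : (J *m ad br X <= J)%MS.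
  by apply: mulmx_subP => v vJ; rewrite mul_ad sQJ.
(* Because J is an abelian ideal, (ad x)^2 kills Q, so the semisimple part s of x centralizes Q and
   is orthogonal to Q = [Q, Q]; the nilpotent part commutes with R and is orthogonal to it. *)
have JR x : (x <= J)%MS -> (x <= R)%MS -> x = 0.
  move=> xJ xR; apply: nondeg_cent => // y yR.
  have [s [m [xsm _ _ mn SE]]] := ad_jordan x nd1.
  have sQ w : (w <= Q)%MS -> br s w = 0.
    move=> wQ; rewrite -mul_ad (SE _ _ 0 2%N) ?scale0r //.
    rewrite raddf0 subr0 expr2 -mulmxE mulmxA !mul_ad Jab //.
    rewrite brC eqmx_opp; apply: sQJ => //.
  have yQ : (y <= Q)%MS by move: yR; rewrite sub_capmx => /andP [].
  have ksQ w : (w <= Q)%MS -> kf br s w = 0.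
    move=> wQ; have : (w <= brs br Q Q)%MS by apply: submx_trans Qp.
    move: w {wQ}; apply: brs_ind => [|u v Hu Hv|a u Hu|u v uQ vQ].
    - exact: kf0r.
    - by rewrite kfDr Hu Hv addr0.
    - by rewrite kfZr Hu mulr0.
    by rewrite -kf_inv sQ // kf0l.
  rewrite xsm kfDl ksQ // add0r; apply: kf_comm_nilp mn.
  have -> : m = x - s by rewrite xsm addrAC subrr add0r.
  by rewrite brBl sQ // Rab // subrr.
case/negP: J0; apply/eqP/eqP; rewrite -submx0; apply/rV_subP => x xJ; rewrite submx0.
have [rs [P sX]] := sdiag_spectral Xs; have [_ _ PX] := sX.
pose E a := horner_mx (ad br X) (P a).
have hE w a : a \in rs -> br X (w *m E a) = a *: (w *m E a).
  move=> ars; apply/eqP; rewrite -subr_eq0 -mul_ad -mul_mx_scalar -mulmxBr -[_ - _]expr1.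
  by rewrite -mulmxA PX ?mulmx0.
rewrite (spectralE sX x) big_seq big1 // => a ars; rewrite -/(E a).
have xaJ : (x *m E a <= J)%MS by apply: spectral_stable.
have xaQ := submx_trans xaJ JQ; have hxa := hE x a ars.
move: (x *m E a) xaJ xaQ hxa => {xJ}{}x xJ xQ hx.
have [a0|a0] := eqVneq a 0.
  apply: JR => //; rewrite sub_capmx xQ; apply/sub_kermxP.
  by rewrite mul_ad hx a0 scale0r.
apply: ndQ => // y yQ; rewrite (spectralE sX y) kf_sumr big_seq big1 // => b brs.
rewrite -/(E b); have hy := hE y b brs.
have {}yQ : (y *m E b <= Q)%MS by apply: spectral_stable => //; apply: stable_ad_mem.
move: (y *m E b) yQ hy => {}y yQ hy.
have [ab|ab] := eqVneq (a + b) 0; last exact: kf_weight ab hx hy.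
(* Opposite eigenvalues put [x, y] in the intersection of J and R, which is 0; by invariance b kf(x,
   y) is, up to sign, kf([x, y], X). *)
have xy0 : br x y = 0.
  have xyJ : (br x y <= J)%MS by rewrite brC eqmx_opp sQJ.
  apply: JR => //; rewrite sub_capmx (submx_trans xyJ JQ); apply/sub_kermxP.
  by rewrite mul_ad jacobi hx hy brZl brZr -scalerDl ab scale0r.
have b0 : b != 0 by apply: contra a0 => /eqP b0; rewrite -ab b0 addr0.
apply: (mulfI b0); rewrite mulr0 -kfZr -hy brC kfNr -kf_inv xy0 kf0l.
by rewrite oppr0.
Qed.

End RegularElement.

End Reductive.

(** * Polynomial functions and deformations of rank *)

Section Polynomials.
Variables (F : fieldType).
Hypothesis ch0 : [pchar F] =i pred0.

Lemma poly_eq0_of_horner (P R : {poly F}) : R != 0 ->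
  (forall t, R.[t] != 0 -> P.[t] = 0) -> P = 0.
Proof.
move=> R0 HP; suff : P * R = 0 by move/eqP; rewrite mulf_eq0 (negPf R0) orbF => /eqP.
apply: contraTeq (leqnn (size (P * R))) => PR0; rewrite -ltnNge.
have rs : all (root (P * R)) [seq k%:R | k <- iota 0 (size (P * R))].
  apply/allP => t _; rewrite /root hornerM.
  by have [->|/HP ->] := eqVneq R.[t] 0; rewrite ?mulr0 ?mul0r.
have := max_poly_roots PR0 rs; rewrite size_map size_iota; apply.
by rewrite map_inj_uniq ?iota_uniq //; apply: natr_pchar_inj.
Qed.

Definition ispoly (g : F -> F) : Prop := exists P : {poly F}, forall s, g s = P.[s].

Lemma ispoly_const c : ispoly (fun=> c).
Proof. by exists c%:P => s; rewrite hornerC. Qed.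

Lemma ispoly_add g1 g2 : ispoly g1 -> ispoly g2 -> ispoly (fun s => g1 s + g2 s).
Proof. by move=> [P HP] [Q HQ]; exists (P + Q) => s; rewrite hornerD HP HQ. Qed.

Lemma ispoly_mul g1 g2 : ispoly g1 -> ispoly g2 -> ispoly (fun s => g1 s * g2 s).
Proof. by move=> [P HP] [Q HQ]; exists (P * Q) => s; rewrite hornerM HP HQ. Qed.

Lemma ispoly_exp k : ispoly (fun s => s ^+ k).
Proof. by exists 'X^k => s; rewrite hornerXn. Qed.

Lemma ispoly_sum (I : Type) (r : seq I) (g : I -> F -> F) :
  (forall i, ispoly (g i)) -> ispoly (fun s => \sum_(i <- r) g i s).
Proof.
move=> Hg; elim: r => [|i r [P HP]]; first by exists 0 => s; rewrite big_nil horner0.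
by have [Q HQ] := Hg i; exists (Q + P) => s; rewrite big_cons hornerD HP HQ.
Qed.

Definition polycurve n (c : F -> 'rV[F]_n) : Prop := forall i, ispoly (fun s => c s 0 i).

Lemma polycurve_const n (v : 'rV[F]_n) : polycurve (fun=> v).
Proof. by move=> i; apply: ispoly_const. Qed.

Lemma polycurve_add n (c1 c2 : F -> 'rV[F]_n) :
  polycurve c1 -> polycurve c2 -> polycurve (fun s => c1 s + c2 s).
Proof.
move=> H1 H2 i; have [P HP] := ispoly_add (H1 i) (H2 i).
by exists P => s; rewrite mxE HP.
Qed.

Lemma polycurve_scale n g (c : F -> 'rV[F]_n) :
  ispoly g -> polycurve c -> polycurve (fun s => g s *: c s).
Proof.
move=> Hg Hc i; have [P HP] := ispoly_mul Hg (Hc i).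
by exists P => s; rewrite mxE HP.
Qed.

Lemma polycurve_mul n m (A : 'M[F]_(n, m)) c : polycurve c -> polycurve (fun s => c s *m A).
Proof.
move=> Hc j.
have [P HP] := ispoly_sum (index_enum 'I_n) (fun i => ispoly_mul (Hc i) (ispoly_const (A i j))).
by exists P => s; rewrite mxE HP.
Qed.

Lemma polycurve_sum n (I : Type) (r : seq I) (c : I -> F -> 'rV[F]_n) :
  (forall i, polycurve (c i)) -> polycurve (fun s => \sum_(i <- r) c i s).
Proof.
move=> Hc j; have [P HP] := ispoly_sum r (fun i => Hc i j).
by exists P => s; rewrite summxE HP.
Qed.

Lemma polyfun_curve n (p : 'rV[F]_n -> F) c : polyfun p -> polycurve c ->
  ispoly (fun s => p (c s)).
Proof.
move=> Hp Hc; elim: Hp => [a|i|q r _ Hq _ Hr|q r _ Hq _ Hr].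
- exact: ispoly_const.
- exact: Hc.
- exact: ispoly_add.
- exact: ispoly_mul.
Qed.

(** [polyfun] speaks of specific function terms; this closes it under pointwise equality, so that
    sums, products and determinants can be treated. *)
Definition polyfun_like n (g : 'rV[F]_n -> F) : Prop :=
  exists2 p, polyfun p & forall v, p v = g v.

Lemma polyfun_like_add n (g1 g2 : 'rV[F]_n -> F) : polyfun_like g1 -> polyfun_like g2 ->
  polyfun_like (fun v => g1 v + g2 v).
Proof.
move=> [p Hp pE] [q Hq qE]; exists (fun v => p v + q v); first exact: pf_add.
by move=> v; rewrite pE qE.
Qed.

Lemma polyfun_like_mul n (g1 g2 : 'rV[F]_n -> F) : polyfun_like g1 -> polyfun_like g2 ->
  polyfun_like (fun v => g1 v * g2 v).
Proof.
move=> [p Hp pE] [q Hq qE]; exists (fun v => p v * q v); first exact: pf_mul.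
by move=> v; rewrite pE qE.
Qed.

Lemma polyfun_like_const n c : polyfun_like (fun _ : 'rV[F]_n => c).
Proof. by exists (fun=> c) => //; apply: pf_const. Qed.

Lemma polyfun_like_sum n (I : Type) (r : seq I) (g : I -> 'rV[F]_n -> F) :
  (forall i, polyfun_like (g i)) -> polyfun_like (fun v => \sum_(i <- r) g i v).
Proof.
move=> Hg; elim: r => [|i r IHr].
  by exists (fun=> 0) => [|v]; [apply: pf_const | rewrite big_nil].
have [p Hp pE] := polyfun_like_add (Hg i) IHr.
by exists p => // v; rewrite big_cons pE.
Qed.

Lemma polyfun_like_prod n (I : Type) (r : seq I) (g : I -> 'rV[F]_n -> F) :
  (forall i, polyfun_like (g i)) -> polyfun_like (fun v => \prod_(i <- r) g i v).
Proof.
move=> Hg; elim: r => [|i r IHr].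
  by exists (fun=> 1) => [|v]; [apply: pf_const | rewrite big_nil].
have [p Hp pE] := polyfun_like_mul (Hg i) IHr.
by exists p => // v; rewrite big_cons pE.
Qed.

Lemma polyfun_like_linear n (c : 'I_n -> F) : polyfun_like (fun v : 'rV[F]_n => \sum_i v 0 i * c i).
Proof.
apply: polyfun_like_sum => i; apply: polyfun_like_mul (polyfun_like_const _ _).
by exists (fun v => v 0 i) => //; apply: pf_coord.
Qed.

Lemma polyfun_like_det n m (A : 'rV[F]_n -> 'M[F]_m) :
  (forall i j, polyfun_like (fun v => A v i j)) -> polyfun_like (fun v => \det (A v)).
Proof.
move=> HA; apply: polyfun_like_sum => s; apply: polyfun_like_mul (polyfun_like_const _ _) _.
exact: polyfun_like_prod.
Qed.

Lemma polyfun_expansion n (p : 'rV[F]_n -> F) (x0 : 'rV[F]_n) : polyfun p ->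
  exists D (Q : 'rV[F]_n -> {poly F}), [/\ forall v, (size (Q v) <= D)%N,
    forall v s, p (x0 + s *: v) = (Q v).[s] & forall k, polyfun_like (fun v => (Q v)`_k)].
Proof.
elim=> [a|i|q r _ [D1 [Q1 [s1 e1 c1]]] _ [D2 [Q2 [s2 e2 c2]]]
  |q r _ [D1 [Q1 [s1 e1 c1]]] _ [D2 [Q2 [s2 e2 c2]]]].
- exists 1%N, (fun=> a%:P); split=> [v|v s|k]; rewrite ?hornerC ?size_polyC ?leq_b1 //.
  exact: polyfun_like_const.
- exists 2%N, (fun v => (x0 0 i)%:P + (v 0 i) *: 'X); split=> [v|v s|k].
  + rewrite (leq_trans (size_polyD _ _)) // geq_max size_polyC.
    by rewrite (leq_trans (leq_b1 _)) // (leq_trans (size_scale_leq _ _)) ?size_polyX.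
  + by rewrite hornerD hornerC hornerZ hornerX !mxE mulrC.
  have [g Hg gE] : polyfun_like (fun v : 'rV[F]_n => (x0 0 i)%:P`_k + v 0 i * 'X`_k).
    apply: polyfun_like_add (polyfun_like_const _ _) _.
    apply: polyfun_like_mul _ (polyfun_like_const _ _).
    by exists (fun v => v 0 i) => //; apply: pf_coord.
  by exists g => // v; rewrite coefD coefZ gE.
- exists (maxn D1 D2), (fun v => Q1 v + Q2 v); split=> [v|v s|k].
  + by rewrite (leq_trans (size_polyD _ _)) // geq_max !leq_max s1 s2 orbT.
  + by rewrite hornerD e1 e2.
  have [g Hg gE] := polyfun_like_add (c1 k) (c2 k).
  by exists g => // v; rewrite coefD gE.
exists (D1 + D2)%N, (fun v => Q1 v * Q2 v); split=> [v|v s|k].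
- rewrite (leq_trans (size_polyMleq _ _)) // (leq_trans (leq_pred _)) //.
  exact: leq_add.
- by rewrite hornerM e1 e2.
have [g Hg gE] := polyfun_like_sum (index_enum 'I_k.+1)
  (fun i : 'I_k.+1 => polyfun_like_mul (c1 i) (c2 (k - i)%N)).
by exists g => // v; rewrite coefM gE.
Qed.

(* The lowest-order term of the expansion of [p] at [x0] vanishes in every
   direction [v], as one sees by following the curve with velocity [v]. *)
Lemma dense_of_curves n (V : 'M[F]_n) (x0 : 'rV[F]_n) (W : 'rV[F]_n -> Prop) :
  (x0 <= V)%MS ->
  (forall v, (v <= V)%MS -> exists c, [/\ polycurve c, c 0 = v,
     forall s, (c s <= V)%MS & forall s, W (x0 + s *: c s)]) ->
  dense_in V W.
Proof.
move=> x0V HW p Hp pW.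
have [D [Q [sQ pQ cQ]]] := polyfun_expansion x0 Hp.
have Q0 k v : (v <= V)%MS -> (Q v)`_k = 0.
  elim/ltn_ind: k v => k IHk v vV.
  have [kD|Dk] := ltnP k D; last by rewrite nth_default // (leq_trans (sQ v)).
  have [c [pc cv cV cW]] := HW v vV.
  have Hc j : ispoly (fun s => (Q (c s))`_(k + j)).
    have [q Hq qE] := cQ (k + j)%N; have [P HP] := polyfun_curve Hq pc.
    by exists P => s; rewrite -qE HP.
  (* P(t) is p(x0 + t c(t)) divided by t^k, the lower coefficients being 0 by induction. It vanishes
     for t nonzero, hence at 0, where its value is coefficient k in the direction c(0) = v. *)
  have [P HP] := ispoly_sum (index_enum 'I_(D - k)) (fun j => ispoly_mul (ispoly_exp j) (Hc j)).
  have P0 : P = 0.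
    apply: (poly_eq0_of_horner (R := 'X)); first by rewrite polyX_eq0.
    move=> t; rewrite hornerX -HP => t0.
    have : (Q (c t)).[t] = 0 by rewrite -pQ pW.
    have sQ' : (size (Q (c t)) <= k + (D - k))%N by rewrite subnKC ?sQ // ltnW.
    rewrite (horner_coef_wide _ sQ') big_split_ord /=.
    rewrite big1 => [|j _]; last by rewrite IHk ?mul0r.
    rewrite add0r => H; apply: (mulfI (expf_neq0 k t0)); rewrite mulr0 -[RHS]H mulr_sumr.
    by apply: eq_bigr => j _; rewrite mulrA -exprD mulrC.
  have := HP 0; rewrite P0 horner0.
  have kD0 : (0 < D - k)%N by rewrite subn_gt0.
  rewrite (bigD1 (Ordinal kD0)) //= expr0 mul1r addn0 cv big1 ?addr0 // => j j0.
  by rewrite expr0n; case: (nat_of_ord j =P 0%N) j0 => [j0|_ _]; rewrite ?mul0r // -val_eqE /= j0.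
move=> v vV; have -> : v = x0 + 1 *: (v - x0) by rewrite scale1r addrC subrK.
rewrite pQ horner_coef big1 // => k _; rewrite Q0 ?mul0r //.
by rewrite addmx_sub ?eqmx_opp.
Qed.

(* Border an invertible rank-sized minor of [A] by a left and a right null
   vector: the bordered minor of [A + t B] is [t u B c + O(t^2)]. *)
Lemma rank_deformation m n (A B : 'M[F]_(m, n)) (R : {poly F}) : R != 0 ->
  (forall t, R.[t] != 0 -> (\rank (A + t *: B)%R <= \rank A)%N) ->
  (kermx A *m B <= A)%MS.
Proof.
move=> R0 Hr; apply: mulmx_subP => u /sub_kermxP uA.
rewrite submxE; apply/eqP/rowP => j; rewrite [RHS]mxE.
pose c := col j (cokermx A).
have Ac : A *m c = 0 by rewrite /c colE mulmxA mulmx_coker mul0mx.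
have -> : (u *m B *m cokermx A) 0 j = (u *m B *m c) 0 0.
  by rewrite /c colE mulmxA -colE [RHS]mxE.
set r := \rank A in Hr *.
pose P1 := pinvmx (col_base A); pose Q1 := pinvmx (row_base A).
have PAQ : P1 *m A *m Q1 = 1%:M.
  transitivity (P1 *m (col_base A *m row_base A) *m Q1); first by rewrite mulmx_base.
  by rewrite mulmxA mulVpmx ?col_base_full // mul1mx mulmxVp // row_base_free.
pose X := P1 *m B *m Q1; pose Y := P1 *m B *m c; pose Z := u *m B *m Q1.
pose w := u *m B *m c.
pose pC a b (M : 'M[F]_(a, b)) := map_mx polyC M.
(* The lower row is already divided by t, so det N at 0 is the scalar w. For t nonzero, t det N is
   an (r + 1)-minor factoring through A + t B, of rank at most r. *)
pose N : 'M[{poly F}]_(r + 1) :=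
  block_mx (1%:M + 'X *: pC _ _ X) ('X *: pC _ _ Y) (pC _ _ Z) (pC _ _ w).
have NE t : (\det N).[t] = \det (block_mx (1%:M + t *: X) (t *: Y) Z w).
  rewrite -horner_evalE -det_map_mx /N; move: X Y Z w {N} => X Y Z w.
  rewrite map_block_mx; congr (\det (block_mx _ _ _ _)); apply/matrixP => a b;
  rewrite !mxE /= /horner_eval ?hornerD ?hornerM ?hornerX ?hornerC //.
  by rewrite -polyC_natr hornerC.
have N0 : \det N = 0.
  apply: (poly_eq0_of_horner (R := R * 'X)); first by rewrite mulf_neq0 ?polyX_eq0.
  move=> t; rewrite hornerM hornerX mulf_eq0 negb_or => /andP [Rt t0].
  apply: (mulfI t0); rewrite mulr0 NE.
  have -> : t * \det (block_mx (1%:M + t *: X) (t *: Y) Z w) =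
      \det (col_mx P1 u *m (A + t *: B) *m row_mx Q1 c).
    rewrite mul_col_mx mul_col_row !mulmxDr !mulmxDl PAQ -[P1 *m A *m c]mulmxA Ac uA.
    rewrite !mul0mx mulmx0 !add0r -!scalemxAr -!scalemxAl -/X -/Y -/Z -/w.
    have -> : block_mx (1%:M + t *: X) (t *: Y) (t *: Z) (t *: w) =
        block_mx 1%:M 0 0 t%:M *m block_mx (1%:M + t *: X) (t *: Y) Z w.
      by rewrite mulmx_block !mul1mx !mul0mx !addr0 !add0r !mul_scalar_mx.
    by rewrite det_mulmx det_lblock det1 mul1r det_scalar1.
  apply/eqP; rewrite -[_ == 0]negbK -unitfE -unitmxE -row_free_unit /row_free neq_ltn.
  rewrite (leq_ltn_trans (mxrankM_maxl _ _)) // (leq_ltn_trans (mxrankM_maxr _ _)) //.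
  by rewrite addn1; apply: Hr.
have := NE 0; rewrite N0 horner0 !scale0r addr0 det_lblock det1 mul1r det_mx11.
by rewrite -/w => <-.
Qed.

End Polynomials.

(** * Curves in orbits and commuting semisimple elements *)

Section Exponential.
Variables (F : closedFieldType) (n' : nat).
Local Notation n := n'.+1.
Variable br : lieBracket F n.
Implicit Types (x y z u v w X : 'rV[F]_n) (a b : F) (A B C L Q R I J V q : 'M[F]_n).

Lemma exp_adE v s x : v *m expmx (ad br (s *: x)) =
  v + s *: \sum_(k < n) ((k.+1)`!%:R^-1 * s ^+ k) *: (v *m ad br x ^+ k.+1).
Proof.
rewrite /expmx mulmx_sumr big_ord_recl expr0 fact0 invr1 scale1r mulmx1; congr (_ + _).
rewrite scaler_sumr; apply: eq_bigr => k _.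
rewrite lift0 adZ exprZn -!scalemxAr !scalerA; congr (_ *: _).
by rewrite mulrCA -exprS.
Qed.

Lemma exp_ad_fix x v : br x v = 0 -> v *m expmx (ad br x) = v.
Proof.
move=> xv; rewrite -[x]scale1r exp_adE big1 ?scaler0 ?addr0 // => k _.
by rewrite exprS -mulmxE mulmxA mul_ad xv mul0mx scaler0.
Qed.

Lemma adjoint_group_mulr A x : adjoint_group br A -> nilpotent_elt br x ->
  adjoint_group br (A *m expmx (ad br x)).
Proof.
move=> GA nx; elim: A / GA => [|y A ny _ IHA].
  by rewrite mul1mx -[expmx _]mulmx1; apply: agexp => //; apply: ag1.
by rewrite -mulmxA; apply: agexp.
Qed.

Variables (e h f F0 : 'rV[F]_n) (V U : 'M[F]_n).

(** The initial velocities at F0 of polynomial curves that stay in the orbit of U; [c] is the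
    difference quotient, the form in which [dense_of_curves] takes its curves. *)
Definition reach v : Prop := exists c, [/\ polycurve c, c 0 = v,
  forall s, (c s <= V)%MS &
  forall s, exists phi y, centralizer_s br e h f phi /\ (y <= U)%MS /\
    F0 + s *: c s = y *m phi].

Lemma reach_base u : (U <= V)%MS -> (F0 <= U)%MS -> (u <= U)%MS -> reach u.
Proof.
move=> UV FU uU; exists (fun=> u); split=> //; first exact: polycurve_const.
  by move=> _; apply: submx_trans UV.
move=> s; exists 1%:M, (F0 + s *: u); rewrite mulmx1; split; last first.
  by rewrite addmx_sub ?scalemx_sub.
by split; rewrite ?mulmx1 //; apply: ag1.
Qed.

(** Moving a given curve by exp(s ad x) at time s adds [x, F0] to its initial velocity and keeps it
    polynomial. *)
Lemma reach_step v x : (V *m ad br x <= V)%MS -> (F0 <= V)%MS -> nilpotent_elt br x ->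
  br x e = 0 -> br x h = 0 -> br x f = 0 -> reach v -> reach (v + br x F0).
Proof.
move=> Vx FV [k xk] xe xh xf [c [pc cv cV cW]].
have VX j w : (w <= V)%MS -> (w *m ad br x ^+ j <= V)%MS.
  move=> wV; elim: j => [|j IHj]; first by rewrite expr0 mulmx1.
  by rewrite exprSr -mulmxE mulmxA; apply: submx_trans (submxMr _ IHj) Vx.
pose g s := \sum_(k < n) ((k.+1)`!%:R^-1 * s ^+ k) *: ((F0 + s *: c s) *m ad br x ^+ k.+1).
exists (fun s => c s + g s); split.
- apply: polycurve_add => //; apply: polycurve_sum => j; apply: polycurve_scale.
    by apply: ispoly_mul; [apply: ispoly_const | apply: ispoly_exp].
  apply: polycurve_mul; apply: polycurve_add; first exact: polycurve_const.
  by apply: polycurve_scale => //; exists 'X => s; rewrite hornerX.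
- rewrite cv /g scale0r addr0 big_ord_recl expr0 expr1 mul_ad.
  rewrite big1 ?addr0 ?fact_1 ?invr1 ?mulr1 ?scale1r // => j _.
  by rewrite lift0 exprS mul0r mulr0 scale0r.
- move=> s; rewrite addmx_sub // summx_sub // => j _.
  by rewrite scalemx_sub // VX // addmx_sub ?scalemx_sub.
move=> s; have [phi [y [[Gphi phie phih phif] [yU yE]]]] := cW s.
exists (phi *m expmx (ad br (s *: x))), y; split; last first.
  by split=> //; rewrite mulmxA -yE exp_adE scalerDr addrA.
have sx w : br x w = 0 -> br (s *: x) w = 0 by move=> xw; rewrite brZl xw scaler0.
split; rewrite ?mulmxA ?phie ?phih ?phif ?exp_ad_fix ?sx //.
by apply: adjoint_group_mulr => //; exists k; rewrite adZ exprZn xk scaler0.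
Qed.

End Exponential.

Section CommutingSemisimple.
Variables (F : closedFieldType) (n' : nat).
Local Notation n := n'.+1.
Implicit Types (A B : 'M[F]_n) (v : 'rV[F]_n).

(** Choose t off the finitely many ratios -a/b of eigenvalues: then a + t b = 0 only for a = b = 0
    on the joint eigenspaces. *)
Lemma sdiag_combination A B : [pchar F] =i pred0 -> A *m B = B *m A ->
  sdiag A -> sdiag B ->
  exists t, sdiag (A + t *: B) /\
    forall v, v *m (A + t *: B) = 0 -> v *m A = 0 /\ v *m B = 0.
Proof.
move=> ch0 cAB /sdiag_spectral [ra [P sA]] /sdiag_spectral [rb [Q sB]].
have [_ a1 PA] := sA; have [_ b1 PB] := sB.
have [|k _ kn] := @iota_notin _ (size [seq - (a / b) | a <- ra, b <- rb])
   [seq - (a / b) | a <- ra, b <- rb] (fun k => k%:R) _ (leqnn _).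
  exact: natr_pchar_inj.
set t := k%:R in kn; exists t.
pose E (ab : F * F) := horner_mx A (P ab.1) *m horner_mx B (Q ab.2).
have EA ab : ab.1 \in ra -> E ab *m A = ab.1 *: E ab.
  move=> ar; rewrite /E -mulmxA (comm_horner_mx (Q ab.2) (esym cAB : comm_mx B A)) mulmxA.
  rewrite scalemxAl; congr (_ *m _); apply/eqP.
  by rewrite -subr_eq0 -mul_mx_scalar -mulmxBr -[_ - _]expr1 PA.
have EB ab : ab.2 \in rb -> E ab *m B = ab.2 *: E ab.
  move=> br; rewrite /E -mulmxA scalemxAr; congr (_ *m _); apply/eqP.
  by rewrite -subr_eq0 -mul_mx_scalar -mulmxBr -[_ - _]expr1 PB.
pose s := [seq (a, b) | a <- ra, b <- rb].
have s1 : \sum_(ab <- s) E ab = 1%:M.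
  rewrite big_allpairs_dep /= -[RHS]mulmx1 -{1}a1 -b1 mulmx_suml.
  by apply: eq_bigr => a _; rewrite mulmx_sumr.
have ms ab : ab \in s -> ab.1 \in ra /\ ab.2 \in rb.
  by case/allpairsP => -[a b] /= [ar br ->].
have Et ab : ab \in s -> E ab *m (A + t *: B) = (ab.1 + t * ab.2) *: E ab.
  by case/ms => ar br; rewrite mulmxDr -scalemxAr EA // EB // scalerA -scalerDl.
split.
  apply: (sdiag_sum (c := fun ab => ab.1 + t * ab.2) s1) => ab abs.
  by rewrite mulmxBr Et // mul_mx_scalar subrr.
move=> v vt.
have cE ab : E ab *m (A + t *: B) = (A + t *: B) *m E ab.
  have cc : comm_mx (A + t *: B) (E ab).
    apply: comm_mxM; apply: comm_mx_horner; apply: comm_mx_sym; apply: comm_mxD;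
      rewrite /comm_mx ?cAB -?scalemxAr -?scalemxAl ?cAB //.
  by rewrite cc.
have vE ab : ab \in s -> v *m E ab *m A = 0 /\ v *m E ab *m B = 0.
  move=> abs; have [ar br] := ms _ abs.
  have : (ab.1 + t * ab.2) *: (v *m E ab) = 0.
    by rewrite scalemxAr -Et // cE mulmxA vt mul0mx.
  move/eqP; rewrite scaler_eq0 => /orP [/eqP abt|/eqP ->]; last by rewrite !mul0mx.
  have b0 : ab.2 = 0.
    apply/eqP; apply: contraT => b0; case/negP: kn; apply/allpairsP.
    exists ab; split=> //; apply: (mulIf b0); rewrite mulNr divfK //.
    by apply/eqP; rewrite -addr_eq0 addrC abt.
  have a0 : ab.1 = 0 by move: abt; rewrite b0 mulr0 addr0.
  by split; rewrite -[LHS]mulmxA ?(EA _ ar) ?(EB _ br) ?a0 ?b0 scale0r mulmx0.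
have vs : v = \sum_(ab <- s) v *m E ab by rewrite -mulmx_sumr s1 mulmx1.
by rewrite vs !mulmx_suml; split; rewrite big_seq big1 // => ab /vE [].
Qed.

End CommutingSemisimple.

(** * The reducing subalgebra *)

Section Toral.
Variables (F : closedFieldType) (n' : nat).
Local Notation n := n'.+1.
Variable br : lieBracket F n.
Implicit Types (x y z u v w a b s : 'rV[F]_n) (A B C L Q : 'M[F]_n).
Hypothesis nd1 : nondeg br 1%:M.

Lemma mem_cent x y : (x <= kermx (ad br y))%MS = (br y x == 0).
Proof. by rewrite -mul_ad; apply/sub_kermxP/eqP. Qed.

Lemma nondeg_ext A B : (forall x, (x <= A)%MS = (x <= B)%MS) -> nondeg br A -> nondeg br B.
Proof. by move=> AB ndA x; rewrite -AB => xA Hx; apply: ndA => // y; rewrite AB; apply: Hx. Qed.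

Lemma cent_subalgebra x : subalgebra br (kermx (ad br x)).
Proof.
apply/brs_subP => y z; rewrite !mem_cent => /eqP xy /eqP xz.
by rewrite jacobi xy xz br0l br0r addr0.
Qed.

Lemma nondeg_cent_sdiag x A : sdiag (ad br x) -> (A *m ad br x <= A)%MS -> nondeg br A ->
  nondeg br (A :&: kermx (ad br x))%MS.
Proof. by move=> xs Ax ndA; apply: nondeg_ker => // y z; rewrite !mul_ad kf_skew. Qed.

Lemma ad_inj0 x : ad br x = 0 -> x = 0.
Proof. by move=> x0; apply: nd1 (submx1 _) _ => y _; rewrite /kf x0 mul0mx mxtrace0. Qed.

(* [L] is an intersection of centralizers, hence contains Jordan components. *)
Variable L : 'M[F]_n.
Hypothesis Lcent : exists S : 'rV[F]_n -> Prop,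
  forall x, (x <= L)%MS <-> forall y, S y -> br x y = 0.
Hypothesis ndL : nondeg br L.

Let La : subalgebra br L.
Proof.
have [S LS] := Lcent; apply/brs_subP => x y /LS xS /LS yS; apply/LS => w Sw.
by have := jacobi br x y w; rewrite (xS w Sw) (yS w Sw) !br0r addr0 => <-.
Qed.

(* Making dim z(a) minimal makes every semisimple element of z_L(a) central in
   z(a); the trace form then leaves no room for nilpotent elements. *)
Lemma max_toral_element : exists a, [/\ (a <= L)%MS, sdiag (ad br a) &
  forall x y, (x <= L)%MS -> br a x = 0 -> br a y = 0 -> br x y = 0].
Proof.
have [S LS] := Lcent.
have [||a [aL as_] amax] := @ex_maxP _ (fun x => \rank (ad br x)) n
    (fun x => (x <= L)%MS /\ sdiag (ad br x)).
- exists 0; rewrite sub0mx ad0; split=> //; exists [:: 0] => //.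
  by rewrite big_seq1 polyC0 subr0 horner_mx_X.
- by move=> x _; apply: rank_leq_row.
(* A suitable a + t x is semisimple with centralizer inside z(a); maximality of the rank of ad a
   gives equality, so x centralizes z(a). *)
have sc x : (x <= L)%MS -> br a x = 0 -> sdiag (ad br x) ->
    forall y, br a y = 0 -> br x y = 0.
  move=> xL ax xs y ay.
  have [t [ts tk]] := sdiag_combination (bracket_pchar br) (ad_comm ax) as_ xs.
  have sK : (kermx (ad br (a + t *: x)) <= kermx (ad br a))%MS.
    apply/rV_subP => v /sub_kermxP; rewrite adD adZ => /tk [va _].
    exact/sub_kermxP.
  have rk : (\rank (kermx (ad br a)) <= \rank (kermx (ad br (a + t *: x))))%N.
    rewrite !mxrank_ker leq_sub2l // amax //; split; last by rewrite adD adZ.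
    by rewrite addmx_sub ?scalemx_sub.
  have {rk}sK' : (kermx (ad br a) <= kermx (ad br (a + t *: x)))%MS.
    by rewrite -(geq_leqif (mxrank_leqif_sup sK)).
  have : (y <= kermx (ad br (a + t *: x)))%MS by apply: submx_trans sK'; rewrite mem_cent ay.
  by move/sub_kermxP; rewrite adD adZ => /tk [_]; rewrite mul_ad.
pose U := (L :&: kermx (ad br a))%MS.
have mU x : (x <= U)%MS <-> (x <= L)%MS /\ br a x = 0.
  by rewrite sub_capmx mem_cent; split=> [/andP [xL /eqP ax]|[-> ->]]; rewrite ?eqxx.
have ndU : nondeg br U.
  apply: nondeg_cent_sdiag => //; apply: mulmx_subP => v vL; rewrite mul_ad.
  exact: mem_subalgebra.
have jd x : (x <= U)%MS -> exists s m, [/\ x = s + m, (s <= U)%MS, (m <= U)%MS,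
    sdiag (ad br s) & ad br m ^+ n = 0].
  move=> /mU [xL ax]; have [s [m [xsm _ sd mn SE]]] := ad_jordan x nd1.
  have sz w : br x w = 0 -> br s w = 0.
    move=> xw; rewrite -mul_ad (SE _ _ 0 1%N) ?scale0r //.
    by rewrite raddf0 subr0 expr1 mul_ad.
  have sU : (s <= U)%MS.
    apply/mU; split; first by apply/LS => y Sy; apply: sz; apply: (proj1 (LS x)).
    by rewrite brC sz ?oppr0 // brC ax oppr0.
  exists s, m; split=> //; have -> : m = x - s by rewrite xsm addrAC subrr add0r.
  by rewrite addmx_sub ?eqmx_opp //; apply/mU.
(* The semisimple part s of x + y commutes with x, y and m, so its traces against them vanish and s
   = 0. Thus x + y is nilpotent too, and kf(x + y, x + y) = 0 polarizes. *)
have nn x y : (x <= U)%MS -> (y <= U)%MS -> ad br x ^+ n = 0 -> ad br y ^+ n = 0 ->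
    kf br x y = 0.
  move=> xU yU xn yn.
  have [s [m [xyE sU mU' sd mn]]] : exists s m, [/\ x + y = s + m, (s <= U)%MS, (m <= U)%MS,
    sdiag (ad br s) & ad br m ^+ n = 0] by apply: jd; rewrite addmx_sub.
  have [sL as0] := proj1 (mU s) sU.
  have trs p w : (w <= U)%MS -> ad br w ^+ n = 0 -> \tr (horner_mx (ad br s) p *m ad br w) = 0.
    move=> /mU [wL aw] wn; rewrite mxtrace_mulC; apply: mxtrace_comm_nilp wn.
    by apply/comm_mx_horner/ad_comm; rewrite brC (sc s) ?oppr0.
  have sn : ad br s ^+ n = 0.
    apply: nilpotent_of_traces (bracket_pchar br) _ => p.
    have adE : ad br s = ad br x + ad br y - ad br m by rewrite -adD xyE adD addrK.
    rewrite [X in _ *m X]adE mulmxBr mulmxDr raddfB raddfD /=.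
    by rewrite !trs // addr0 subr0.
  have s0 : s = 0.
    apply: ad_inj0; apply/row_matrixP => i; rewrite rowE row0.
    by apply: (sdiag_ker (k := n) sd); rewrite sn mulmx0.
  have : kf br (x + y) (x + y) = 0.
    by rewrite xyE s0 add0r; apply: kf_comm_nilp mn; apply: brxx.
  rewrite kfDl !kfDr (kf_comm_nilp (brxx br x) xn) (kf_comm_nilp (brxx br y) yn).
  rewrite add0r addr0 [kf br y x]kfC -mulr2n -mulr_natr => /eqP.
  by rewrite mulf_eq0 (negPf (natr_neq0 br 1)) orbF => /eqP.
exists a; split=> // x y xL ax ay.
have [s [m [xsm sU mU' sd mn]]] := jd x (proj2 (mU x) (conj xL ax)).
suff m0 : m = 0 by rewrite xsm m0 addr0; apply: sc => //; apply mU.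
apply: ndU => // w wU; have [t [k [wtk tU kU td kn]]] := jd w wU.
have [tL at0] := proj1 (mU t) tU; have [_ am0] := proj1 (mU m) mU'.
rewrite wtk kfDr (nn m k) // addr0; apply: kf_comm_nilp mn.
by rewrite brC (sc t) ?oppr0.
Qed.

End Toral.

(** * Cyclic elements, the subalgebra q and density *)

Section Main.
Variables (F : closedFieldType) (n' : nat).
Local Notation n := n'.+1.
Variable br : lieBracket F n.
Implicit Types (x y z u v w : 'rV[F]_n).
Variables (e h f : 'rV[F]_n) (d : nat).
Hypothesis sl2 : sl2_triple br e h f.
Hypothesis en : nilpotent_elt br e.
Hypothesis nd1 : nondeg br 1%:M.
Hypothesis e0 : e != 0.
Hypothesis hd : is_depth br 1%:M h d.

Let he : br h e = 2%:R *: e. Proof. by case: sl2. Qed.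
Let hf : br h f = - 2%:R *: f. Proof. by case: sl2 => _ -> _; rewrite scaleNr. Qed.
Let ef : br e f = h. Proof. by case: sl2. Qed.

Local Notation V := (grade br 1%:M h (- d%:Z)).
Local Notation zs := (kermx (ad br e) :&: kermx (ad br h))%MS.
Local Notation wd := ((- d%:Z)%:~R : F).

Let mV x : (x <= V)%MS = (br h x == wd *: x).
Proof. by rewrite mem_grade submx1. Qed.

Let mzs x : (x <= zs)%MS = (br e x == 0) && (br h x == 0).
Proof. by rewrite sub_capmx !mem_cent. Qed.

Let zsf x : (x <= zs)%MS -> br f x = 0.
Proof. by rewrite mzs => /andP [/eqP ex /eqP hx]; apply: (centralize_e_h sl2). Qed.

Lemma wd_neq0 : wd != 0.
Proof.
have := depth_ge2 sl2 e0 hd; rewrite (intr_eq0_pchar (bracket_pchar br)).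
by move=> d2; lia.
Qed.

Lemma wd_neq2 : (2%:R : F) != wd.
Proof.
rewrite -subr_eq0 -(rmorph_nat (intr : int -> F)) -rmorphB /=.
by rewrite (intr_eq0_pchar (bracket_pchar br)); lia.
Qed.

(** The summands [e, x] and [v, x] have the distinct weights 2 and -d, so each vanishes. *)
Lemma cyclic_centralizer_weight0 v x : (v <= V)%MS -> br h x = 0 -> br (e + v) x = 0 ->
  br e x = 0 /\ br v x = 0.
Proof.
rewrite mV => /eqP hv hx; rewrite brDl => /eqP; rewrite addr_eq0 => /eqP E.
have h1 : br h (br e x) = 2%:R *: br e x by rewrite jacobi he hx br0r addr0 brZl.
have h2 : br h (br v x) = wd *: br v x by rewrite jacobi hv hx br0r addr0 brZl.
have ex : br e x = 0.
  have : (2%:R - wd) *: br e x = 0.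
    rewrite scalerBl -h1 [in X in _ - X]E scalerN -h2 -brNr -E subrr.
    by [].
  by move/eqP; rewrite scaler_eq0 subr_eq0 (negPf wd_neq2) => /eqP.
by split=> //; apply: oppr_inj; rewrite -E ex oppr0.
Qed.

Hypothesis st : semisimple_type br 1%:M e h d.

Lemma generic_cyclic_element : exists p0 F0, [/\ polyfun p0, p0 F0 != 0, (F0 <= V)%MS,
  forall v, (v <= V)%MS -> p0 v != 0 -> sdiag (ad br (e + v)) &
  forall x v, (x <= zs)%MS -> br F0 x = 0 -> (v <= V)%MS ->
    (br v x <= zs *m ad br F0)%MS].
Proof.
have [S [Spf [v0 [v0V [p0 [Sp0 p0v0]]]] HS]] := st.
have p0d v : (v <= V)%MS -> p0 v != 0 -> sdiag (ad br (e + v)).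
  by move=> vV pv; apply: semisimple_elt_sdiag; apply: HS => //; exists p0.
have [||F0 [F0V pF0] maxF0] := @ex_maxP _ (fun v => \rank (zs *m ad br v)%R) n
    (fun v => (v <= V)%MS /\ p0 v != 0).
- by exists v0.
- by move=> v _; apply: rank_leq_row.
exists p0, F0; split=> // [|x v xzs Fx vV]; first exact: Spf.
have [R HR] : ispoly (fun t => p0 (F0 + t *: v)).
  apply: polyfun_curve (Spf _ Sp0) _; apply: polycurve_add; first exact: polycurve_const.
  by apply: polycurve_scale; [exists 'X => s; rewrite hornerX | apply: polycurve_const].
have R0 : R != 0.
  by apply: contraNneq pF0 => R0; rewrite -[F0]addr0 -(scale0r v) HR R0 horner0.
(* [R] excludes the t for which F0 + t v leaves the open set over which the rank was maximized. *)
have sub : (kermx (zs *m ad br F0) *m (zs *m ad br v) <= zs *m ad br F0)%MS.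
  apply: (rank_deformation (bracket_pchar br) R0) => t; rewrite -HR => pt.
  rewrite scalemxAr -mulmxDr -adZ -adD; apply: maxF0; split=> //.
  by rewrite addmx_sub ?scalemx_sub.
have /submxP [w xw] := xzs; rewrite -mul_ad xw -mulmxA; apply: submx_trans sub.
by apply: submxMr; apply/sub_kermxP; rewrite mulmxA -xw mul_ad.
Qed.

Lemma kf_automorphism (s : 'M[F]_n) :
  (forall x y, br x y *m s = br (x *m s) (y *m s)) -> s \in unitmx ->
  forall x y, kf br (x *m s) (y *m s) = kf br x y.
Proof.
move=> sbr su x y.
have adE z : ad br (z *m s) = invmx s *m ad br z *m s.
  apply: adP => w; rewrite !mulmxA mul_ad sbr -mulmxA.
  by rewrite mulVmx // mulmx1.
rewrite /kf.
have -> : ad br (x *m s) *m ad br (y *m s) = invmx s *m (ad br x *m ad br y *m s).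
  by rewrite !adE !mulmxA mulmxK.
by rewrite mxtrace_mulC mulmxK.
Qed.

Theorem reducing_subalgebra : exists q : 'M[F]_n,
  [/\ reducing br e h f d q, (e <= q)%MS & regular_semisimple_type_in br q e].
Proof.
have [p0 [F0 [Hp0 pF0 F0V p0d slice]]] := generic_cyclic_element.
have [zeta [sg [prz sbr su skill [sgfix sgcyc]]]] := grading_automorphism sl2 en nd1 e0 hd.
have sgsd : sdiag sg.
  by exists [seq zeta ^+ i | i <- iota 0 d.+2] => //; apply: prim_root_map_uniq prz.
have sgiso := kf_automorphism sbr su.
have z0 : zeta ^+ 2 != 0.
  rewrite expf_neq0 //; apply/eqP => zz; have := prim_expr_order prz.
  by rewrite zz exprS mul0r => /esym/eqP; rewrite oner_eq0.
have hF0 : br h F0 = wd *: F0 by apply/eqP; rewrite -mV.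
have sg_cent v x : (v <= V)%MS -> br (e + v) x = 0 -> br (e + v) (x *m sg) = 0.
  rewrite mV => /eqP hv evx; apply: (scalerI z0); rewrite scaler0 -brZl -sgcyc //.
  by rewrite -sbr evx mul0mx.
pose L := (zs :&: kermx (ad br F0))%MS.
have mL x : (x <= L)%MS = (x <= zs)%MS && (br F0 x == 0).
  by rewrite [LHS]sub_capmx mem_cent.
(* L is the sigma-fixed part of z(e + F0): first the kernel of the skew diagonalizable ad(e + F0),
   then the fixed space of the diagonalizable isometry sigma. *)
have ndL : nondeg br L.
  have nd2 : nondeg br (1%:M :&: kermx (ad br (e + F0)))%MS.
    by apply: nondeg_cent_sdiag => //; [apply: p0d | apply: submx1].
  have nd3 := nondeg_fix nd2 sgsd _ sgiso.
  apply: nondeg_ext (nd3 _); last first.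
    apply: mulmx_subP => v; rewrite !sub_capmx !submx1 !mem_cent /= => /eqP Hv.
    by rewrite sg_cent.
  move=> x; rewrite mL mzs [LHS]sub_capmx [X in X && _]sub_capmx submx1 mem_cent /=.
  have -> : (x <= kermx (sg - 1%:M))%MS = (br h x == 0).
    apply/sub_kermxP/eqP => [xs|hx].
      by apply/sgfix/eqP; rewrite -subr_eq0 -[X in _ - X]mulmx1 -mulmxBr xs.
    by rewrite mulmxBr mulmx1 (proj2 (sgfix x) hx) subrr.
  apply/andP/andP => [[/eqP ex /eqP hx]|[/andP [/eqP ex /eqP hx] /eqP Fx]].
    have [-> ->] := cyclic_centralizer_weight0 F0V hx ex.
    by rewrite hx eqxx.
  by rewrite brDl ex Fx hx addr0 eqxx.
have Lcent : exists S : 'rV[F]_n -> Prop,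
    forall x, (x <= L)%MS <-> forall y, S y -> br x y = 0.
  exists (fun y => [\/ y = e, y = h | y = F0]) => x; rewrite mL mzs; split.
    by move=> /andP [/andP [/eqP ex /eqP hx] /eqP Fx] y [] ->; rewrite brC ?ex ?hx ?Fx oppr0.
  move=> H; rewrite brC (H e) ?oppr0 ?eqxx; last by constructor 1.
  rewrite brC (H h) ?oppr0 ?eqxx; last by constructor 2.
  by rewrite brC (H F0) ?oppr0 ?eqxx //; constructor 3.
have [a [aL ad_a acen]] := max_toral_element nd1 Lcent ndL.
have azs : (a <= zs)%MS by move: aL; rewrite mL => /andP [].
have [ae ah] : br a e = 0 /\ br a h = 0.
  by move: azs; rewrite mzs => /andP [/eqP ea /eqP ha]; rewrite !(brC _ a) ea ha oppr0.
have af : br a f = 0 by rewrite brC zsf ?oppr0.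
have aF : br a F0 = 0 by move: aL; rewrite mL => /andP [_ /eqP Fa]; rewrite brC Fa oppr0.
pose c := kermx (ad br a); pose q := brs br c c.
have mc x : (x <= c)%MS = (br a x == 0) by apply: mem_cent.
have ca : subalgebra br c by apply: cent_subalgebra.
have ndc : nondeg br c.
  apply: nondeg_ext (nondeg_cent_sdiag ad_a (submx1 _) nd1) => x.
  by rewrite sub_capmx submx1.
have qc : (q <= c)%MS by [].
have qa : subalgebra br q by apply: brs_mono.
have ndq : nondeg br q by apply: nondeg_derived.
have qp : (q <= brs br q q)%MS by apply: derived_perfect.
(* Since h lies in c, a vector of c of nonzero weight k is the bracket of h with its multiple by
   1/k. So passing from c to [c, c] loses nothing in V. *)
have weightq x k : k != 0 -> br a x = 0 -> br h x = k *: x -> (x <= q)%MS.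
  move=> k0 ax hx; rewrite -[x](scalerK k0) -hx scalemx_sub // mem_brs // mc ?ah //.
  by rewrite ax.
have two0 := natr_neq0 br 1.
have eq_ : (e <= q)%MS by apply: weightq two0 ae he.
have fq : (f <= q)%MS by apply: (weightq f (- 2%:R)); rewrite ?oppr_eq0.
have hq : (h <= q)%MS by rewrite -ef mem_subalgebra.
have F0q : (F0 <= q)%MS by apply: weightq wd_neq0 aF hF0.
have qL x : (x <= q)%MS -> (x <= zs)%MS -> br F0 x = 0 -> x = 0.
  move=> xq xzs Fx; have xc := submx_trans xq qc.
  have ax : br a x = 0 by apply/eqP; rewrite -mc.
  apply: (center_cap_derived ca ndc) => // y; rewrite mc => /eqP ay.
  by apply: acen => //; rewrite mL xzs Fx eqxx.
have csg : (c *m sg <= c)%MS.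
  apply: mulmx_subP => v; rewrite !mc => /eqP av.
  have ha : br h a = 0 by rewrite brC ah oppr0.
  by rewrite -{1}(proj2 (sgfix a) ha) -sbr av mul0mx.
have qsg : (q *m sg <= q)%MS.
  apply: brs_mul => u v uc vc; rewrite sbr mem_brs //.
    by apply: submx_trans (submxMr _ uc) csg.
  by apply: submx_trans (submxMr _ vc) csg.
(* Kept general in v: F0 serves for semisimplicity of q, generic v for the regular semisimple
   type. *)
have abel v : (v <= V)%MS -> (forall x, (x <= q)%MS -> (x <= zs)%MS -> br v x = 0 -> x = 0) ->
    p0 v != 0 -> (v <= q)%MS ->
    let R := (q :&: kermx (ad br (e + v)))%MS in
    forall x y, (x <= R)%MS -> (y <= R)%MS -> br x y = 0.
  move=> vV vinj pv vq R.
  have Ra : subalgebra br R.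
    apply/brs_subP => x y; rewrite !sub_capmx => /andP [xq xk] /andP [yq yk].
    by rewrite !mem_subalgebra //; apply: cent_subalgebra.
  have ndR : nondeg br R.
    by apply: nondeg_cent => //; [rewrite addmx_sub | apply: p0d].
  apply: (fixed_point_free_abelian prz sbr skill Ra ndR).
    apply: mulmx_subP => x; rewrite !sub_capmx !mem_cent => /andP [xq /eqP xk].
    by rewrite sg_cent // eqxx andbT (submx_trans (submxMr _ xq)).
  move=> x; rewrite sub_capmx mem_cent => /andP [xq /eqP xk] /sgfix hx.
  have [ex vx] := cyclic_centralizer_weight0 vV hx xk.
  by apply: vinj => //; rewrite mzs ex hx eqxx.
have ssq : semisimple_lie br q.
  apply: (semisimple_of_regular (X := e + F0)) => //.
  - by rewrite addmx_sub.
  - exact: p0d.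
  exact: abel.
(* Otherwise e itself would be both nilpotent and semisimple. *)
have F00 : F0 != 0.
  apply: contra_neq e0 => F00; have := p0d F0 F0V pF0; rewrite F00 addr0 => es.
  have [k ek] := en; apply: (ad_inj0 nd1); apply/row_matrixP => i; rewrite rowE row0.
  by apply: (sdiag_ker (k := k) es); rewrite ek mulmx0.
have cyc v : (v <= V)%MS -> (forall x, (x <= q)%MS -> (x <= zs)%MS -> br v x = 0 -> x = 0) ->
    p0 v != 0 -> (v <= q)%MS -> regular_semisimple_elt br q (e + v).
  move=> vV vinj pv vq; have Xq : ((e + v)%R <= q)%MS by rewrite addmx_sub.
  have Xs : sdiag (ad br (e + v)) by apply: p0d.
  split; last by apply: cartan_cent => //; apply: abel.
  by apply: sdiag_semisimple_elt => //; apply: stable_ad_mem.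
(* The nonzero vector F0 of q has weight -d, and the form, nondegenerate on q, must pair it with
   weight d. *)
have depthq : is_depth br q h d.
  split=> [|j dj]; last first.
    apply: submx_trans (proj2 hd j dj); apply/rV_subP => x; rewrite !mem_grade submx1.
    by case/andP.
  apply: contra F00; rewrite submx0 => /eqP gq0; apply/eqP; apply: ndq => // y yq.
  have [P sH] := h_spectral sl2 en nd1 e0 hd; have [_ _ PH] := sH.
  rewrite (spectralE sH y) kf_sumr big_map big_seq big1 // => j jw; set y' := y *m _.
  have y'q : (y' <= q)%MS.
    apply: spectral_stable => //; apply: mulmx_subP => v vq; rewrite mul_ad.
    exact: mem_subalgebra.
  have hy' : br h y' = wt F d j *: y'.
    apply/eqP; rewrite -subr_eq0 -mul_ad -mul_mx_scalar -mulmxBr -[_ - _]expr1.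
    by rewrite -mulmxA PH ?mulmx0 ?map_f.
  have [jd|jd] := eqVneq (j%:Z - d%:Z) d%:Z.
    have : (y' <= grade br q h d%:Z)%MS by rewrite mem_grade y'q hy' /wt jd eqxx.
    by rewrite gq0 submx0 => /eqP ->; rewrite kf0r.
  apply: kf_weight hF0 hy'; rewrite -rmorphD /= (intr_eq0_pchar (bracket_pchar br)).
  by rewrite addrC subr_eq0.
exists q; split=> //; last first.
  exists h, f, d; split=> //.
  pose B := row_base (q :&: zs)%MS.
  have Bq : (B <= q :&: zs)%MS by rewrite eq_row_base.
  (* With D a right inverse at F0, the determinant of B (ad v) D is polynomial in v, equals 1 at F0,
     and where nonzero makes ad v injective on the part of zs in q. *)
  have /row_freeP [D BD] : row_free (B *m ad br F0).
    rewrite -kermx_eq0; apply/rowV0P => w /sub_kermxP wB.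
    apply: (row_free_inj (row_base_free (q :&: zs)%MS)); rewrite mul0mx.
    have := submx_trans (submxMl w B) Bq; rewrite sub_capmx => /andP [xq xzs].
    by apply: qL => //; rewrite -mul_ad -mulmxA.
  have [p1 Hp1 p1E] : polyfun_like (fun v => p0 v * \det (B *m ad br v *m D)).
    apply: polyfun_like_mul; first by exists p0.
    apply: polyfun_like_det => i j.
    have [g Hg gE] := polyfun_like_linear (fun k => (B *m ad br (delta_mx 0 k) *m D) i j).
    exists g => // v; rewrite gE {2}(row_sum_delta v) (big_morph (ad br) (adD br) (ad0 br)).
    rewrite mulmx_sumr mulmx_suml summxE; apply: eq_bigr => k _.
    by rewrite adZ -scalemxAr -scalemxAl [RHS]mxE.
  exists (eq p1); split=> [_ <- //||v].
    exists F0; split; first by rewrite mem_grade F0q hF0 eqxx.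
    by exists p1; split=> //; rewrite p1E BD det1 mulr1.
  rewrite mem_grade => /andP [vq hv] [_ [<-]]; rewrite p1E mulf_eq0 negb_or.
  case/andP=> pv detv; apply: cyc => //; first by rewrite mV.
  move=> x xq xzs vx; have /submxP [w xw] : (x <= B)%MS.
    by rewrite eq_row_base sub_capmx xq.
  have : w *m (B *m ad br v *m D) = 0.
    by rewrite [w *m _]mulmxA [w *m (_ *m _)]mulmxA -xw mul_ad vx mul0mx.
  move: detv; rewrite -unitfE -unitmxE => Bu /(congr1 (mulmx^~ (invmx (B *m ad br v *m D)))).
  by rewrite mulmxK // mul0mx xw => ->; rewrite mul0mx.
have stq x : (x <= q)%MS -> (q *m ad br x <= q)%MS.
  by move=> xq; apply: mulmx_subP => v vq; rewrite mul_ad mem_subalgebra.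
split; [by [] | exact: stq | exact: stq | exact: stq |].
pose U := (q :&: V)%MS.
have mU x : (x <= U)%MS = (x <= q)%MS && (x <= V)%MS by apply: sub_capmx.
have UV : (U <= V)%MS by apply: capmxSr.
have F0U : (F0 <= U)%MS by rewrite mU F0q.
have zsV x : (x <= zs)%MS -> (V *m ad br x <= V)%MS.
  rewrite mzs => /andP [_ /eqP hx]; apply: mulmx_subP => v; rewrite mul_ad !mV => /eqP hv.
  by rewrite jacobi hx br0l add0r hv brZr.
have zsa : (zs *m ad br a <= zs)%MS.
  apply: mulmx_subP => x; rewrite mul_ad !mzs => /andP [/eqP ex /eqP hx].
  rewrite (jacobi br e) (jacobi br h) ex hx (brC br e a) (brC br h a) ae ah.
  by rewrite !(br0r, oppr0, br0l, addr0) eqxx.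
apply: (dense_of_curves (bracket_pchar br) (x0 := F0)) => // v vV.
suff : reach br e h f F0 V U v by [].
have [rs [P sA]] := sdiag_spectral ad_a; have [Urs s1 PA] := sA.
pose E b := horner_mx (ad br a) (P b).
have EV b : (v *m E b <= V)%MS by apply: spectral_stable => //; apply: zsV.
have Ea w b : b \in rs -> br a (w *m E b) = b *: (w *m E b).
  move=> brs; apply/eqP; rewrite -subr_eq0 -mul_ad -mul_mx_scalar -mulmxBr -[_ - _]expr1.
  by rewrite -mulmxA PA ?mulmx0.
rewrite (spectralE sA v) (bigID (pred1 0)) /=.
set u := \sum_(b <- rs | b == 0) _.
have uU : (u <= U)%MS.
  rewrite /u big_seq_cond summx_sub // => b /andP [brs /eqP b0].
  rewrite mU EV andbT; have := EV b; rewrite mV => /eqP.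
  by apply: weightq wd_neq0 _; rewrite Ea // b0 scale0r.
have step b w : b \in rs -> b != 0 -> reach br e h f F0 V U w ->
    reach br e h f F0 V U (w + v *m E b).
  move=> brs b0 Rw.
  have /submxP [t tE] : (b *: (v *m E b) <= zs *m ad br F0)%MS.
    rewrite -Ea // brC eqmx_opp; apply: slice (EV b) => //.
    by rewrite brC aF oppr0.
  (* Projecting by [E b] makes x an eigenvector of ad a for b, hence ad-nilpotent; as [a, F0] = 0,
     [E b] commutes with ad F0 and the bracket with F0 is still the wanted component. *)
  pose x := - (b^-1 *: (t *m zs)) *m E b.
  have xzs : (x <= zs)%MS.
    by apply: spectral_stable => //; rewrite eqmx_opp scalemx_sub ?submxMl.
  have ax : br a x = b *: x by apply: Ea.
  have vbE : v *m E b = br x F0.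
    have aF' : comm_mx (E b) (ad br F0) by apply/comm_horner_mx/ad_comm.
    rewrite brC -mul_ad /x !mulNmx opprK -mulmxA aF' mulmxA -scalemxAl -mulmxA -tE.
    by rewrite scalerK // -mulmxA (spectral_idem sA).
  have := xzs; rewrite mzs => /andP [/eqP ex /eqP hx].
  rewrite vbE; apply: reach_step => //; first exact: zsV.
  - by apply: ad_nilpotent_eigen b0 ax.
  - by rewrite brC ex oppr0.
  - by rewrite brC hx oppr0.
  by rewrite brC zsf ?oppr0.
rewrite -big_filter.
have : all (fun b => (b \in rs) && (b != 0)) [seq b <- rs | b != 0].
  by apply/allP => b; rewrite mem_filter => /andP [-> ->].
elim/last_ind: (filter _ _) => [|r b IHr].
  by rewrite big_nil addr0 => _; apply: reach_base.
rewrite all_rcons => /andP [/andP [brs b0] /IHr Rr].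
by rewrite -cats1 big_cat big_seq1 addrA; apply: step.
Qed.

End Main.

Theorem theorem3p11 (F : closedFieldType) (n : nat)
  (br : 'rV[F]_n -> 'rV[F]_n -> 'rV[F]_n) (e h f : 'rV[F]_n) (d : nat) :
  [pchar F] =i pred0 ->
  lie_bracket br ->
  semisimple_lie br 1%:M ->
  e != 0 ->
  nilpotent_elt br e ->
  sl2_triple br e h f ->
  is_depth br 1%:M h d ->
  ~~ odd d ->
  semisimple_type br 1%:M e h d ->
  exists q : 'M[F]_n,
    [/\ reducing br e h f d q, (e <= q)%MS & regular_semisimple_type_in br q e].
Proof.
case: n br e h f => [|n'] br e h f ch0 lie ss e0 en sl2 hd _ st.
  by rewrite [e]thinmx0 eqxx in e0.
pose B := LieBracket lie ch0.
exact: (reducing_subalgebra (br := B) sl2 en (killing_nondeg (br := B) ss) e0 hd st).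
Qed.
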